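(* Let $((A,\mu),(M,l,r),T)$ be a relative Rota-Baxter algebra over a field of characteristic $0$, and let $\pi=\mu+l+r$. Then $L'[1]\oplus\mathfrak a$ with the twisted operations $\{l_k^{(\pi[1],T)}\}_{k\ge1}$ is an $L_\infty[1]$-algebra. Moreover, for any linear maps $\mu'\in\mathrm{Hom}(A^{\otimes2},A)$, $l'\in\mathrm{Hom}(A\otimes M,M)$, $r'\in\mathrm{Hom}(M\otimes A,M)$, $T'\in\mathrm{Hom}(M,A)$, the triple $((A,\mu+\mu'),(M,l+l',r+r'),T+T')$ is a relative Rota-Baxter algebra if and only if $(\pi'[1],T')$, with $\pi'=\mu'+l'+r'\in L'_1$, is a Maurer-Cartan element in the $L_\infty[1]$-algebra $(L'[1]\oplus\mathfrak a,\{l_k^{(\pi[1],T)}\}_{k\ge1})$.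
   Context: Relative Rota-Baxter algebra: a triple $((A,\mu),(M,l,r),T)$ where $(A,\mu)$ is an associative algebra, $(M,l,r)$ is an $A$-bimodule with left action $l(a,m)=am$ and right action $r(m,a)=ma$, and $T:M\to A$ is linear with $T(m)T(n)=T(T(m)n+mT(n))$ for all $m,n\in M$. Gerstenhaber bracket: for a vector space $V$, $f\in\mathrm{Hom}(V^{\otimes m+1},V)$, $g\in\mathrm{Hom}(V^{\otimes n+1},V)$, put $(f\diamond g)(v_1,\ldots,v_{m+n+1})=\sum_{i=1}^{m+1}(-1)^{(i-1)n}f(v_1,\ldots,v_{i-1},g(v_i,\ldots,v_{i+n}),v_{i+n+1},\ldots,v_{m+n+1})$ and $[f,g]=f\diamond g-(-1)^{mn}g\diamond f$; $\mathrm{Hom}(V^{\otimes n+1},V)$ has degree $n$. Take $V=A\oplus M$, $L=\bigoplus_{n\ge0}\mathrm{Hom}((A\oplus M)^{\otimes n+1},A\oplus M)$; multilinear maps on tensor products of copies of $A$ and $M$ are extended by zero to $A\oplus M$. Let $L'=\bigoplus_{n\ge0}L'_n$ with $L'_n=\mathrm{Hom}(A^{\otimes n+1},A)\oplus\mathrm{Hom}(\mathcal A^{n,1},M)$, where $\mathcal A^{n,1}$ is the direct sum of all tensor products of $n$ copies of $A$ and one copy of $M$ in any order (a graded Lie subalgebra of $L$). Let $\mathfrak a=\bigoplus_{n\ge0}\mathrm{Hom}(M^{\otimes n+1},A)$, with $\mathrm{Hom}(M^{\otimes n+1},A)$ in degree $n$, and $P:L\to\mathfrak a$ the projection. An $L_\infty[1]$-algebra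 is a graded vector space $W$ with degree $1$ graded symmetric multilinear maps $l_k:W^{\otimes k}\to W$, $k\ge1$, such that for all $n\ge1$, $\sum_{i+j=n+1}\sum_{\sigma\in S_{(i,n-i)}}\epsilon(\sigma)\,l_j(l_i(x_{\sigma(1)},\ldots,x_{\sigma(i)}),x_{\sigma(i+1)},\ldots,x_{\sigma(n)})=0$, with $S_{(i,n-i)}$ the $(i,n-i)$-shuffles and $\epsilon(\sigma)$ the Koszul sign. A Maurer-Cartan element is a degree $0$ element $\alpha$ with $\sum_{k\ge1}\frac1{k!}l_k(\alpha,\ldots,\alpha)=0$. With $(L'[1])_i=L'_{i+1}$, $L'[1]\oplus\mathfrak a$ is an $L_\infty[1]$-algebra with $l_2(Q[1],Q'[1])=(-1)^{|Q|}[Q,Q'][1]$ and $l_k(Q[1],\theta_1,\ldots,\theta_{k-1})=P[\cdots[[Q,\theta_1],\theta_2],\ldots,\theta_{k-1}]$ for $k\ge2$ ($Q,Q'\in L'$ and $\theta_i\in\mathfrak a$ homogeneous); up to graded-symmetric permutation of arguments all other operations vanish. The element $\alpha=(\pi[1],T)$ is a Maurer-Cartan element of it, and the twisted operations are $l_k^{\alpha}(x_1,\ldots,x_k)=\sum_{n\ge0}\frac1{n!}l_{k+n}(\underbrace{\alpha,\ldots,\alpha}_{n},x_1,\ldots,x_k)$ (all sums here are finite). *)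

(* Defs.v *)
From HB Require Import structures.
From mathcomp Require Import all_boot all_order all_algebra all_fingroup.
From mathcomp Require Import boolp classical_sets functions cardinality fsbigop.

Set Implicit Arguments.
Unset Strict Implicit.
Unset Printing Implicit Defensive.

Import GRing.Theory.
Local Open Scope ring_scope.

Section RelativeRotaBaxter.

Variables (K : fieldType).

Definition is_bilinear (X Y Z : lmodType K) (f : X -> Y -> Z) : Prop :=
  (forall x, linear (f x)) /\ (forall y, linear (f^~ y)).

Variables (A M : lmodType K).

Definition assoc_algebra (mu : A -> A -> A) : Prop :=
  is_bilinear mu /\ associative mu.

Record bimodule (mu : A -> A -> A) (l : A -> M -> M) (r : M -> A -> M) : Prop :=
  Bimodule {
    bimod_l_bilinear : is_bilinear l;
    bimod_r_bilinear : is_bilinear r;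
    bimod_left : forall a b m, l (mu a b) m = l a (l b m);
    bimod_right : forall m a b, r m (mu a b) = r (r m a) b;
    bimod_middle : forall a m b, r (l a m) b = l a (r m b)
  }.

Record relative_RB_algebra (mu : A -> A -> A) (l : A -> M -> M)
    (r : M -> A -> M) (T : M -> A) : Prop := RelativeRBAlgebra {
  rRB_algebra : assoc_algebra mu;
  rRB_bimodule : bimodule mu l r;
  rRB_linear : linear T;
  rRB_identity : forall m n, mu (T m) (T n) = T (l (T m) n + r m (T n))
}.

End RelativeRotaBaxter.

(* A graded vector space is a family [W d], [d : int], of subspaces of one
   ambient module [U]; the ambient module only serves to avoid transports
   between [W d] and [W e] when [d = e], and nothing is required of elements
   outside the [W d].  A homogeneous element is a pair [(d, x)] with
   [x \in W d].  A family of operations [l_k : W^{(x) k} -> W] is a function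
   [l] on sequences of such pairs: [l [:: (d_1, x_1); ...; (d_k, x_k)]] is
   [l_k (x_1, ..., x_k)], for [x_i] of degree [d_i]. *)
Section LInfinity.

Variables (K : fieldType) (U : lmodType K).

Implicit Types (W : int -> {pred U}) (l : seq (int * U) -> U).

Definition homogeneous W (X : seq (int * U)) : bool :=
  all (fun x => x.2 \in W x.1) X.

Definition tot_deg (X : seq (int * U)) : int := \sum_(x <- X) x.1.

Definition permute n (X : n.-tuple (int * U)) (s : 'S_n) : seq (int * U) :=
  [seq tnth X (s a) | a <- enum 'I_n].

(* x_1 ... x_n = koszul X s x_(s 1) ... x_(s n) in the free graded
   commutative algebra. *)
Definition koszul n (X : n.-tuple (int * U)) (s : 'S_n) : K :=
  \prod_(a < n) \prod_(b < n | (a < b)%N && (s b < s a)%N)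
     (-1) ^ ((tnth X (s a)).1 * (tnth X (s b)).1).

Definition shuffle n (i : nat) (s : 'S_n) : bool :=
  [forall a : 'I_n, forall b : 'I_n,
     ((a < b)%N && ((b < i)%N || (i <= a)%N)) ==> (s a < s b)%N].

(* l_j (l_i (x_1, ..., x_i), x_(i+1), ..., x_n), with i + j = n + 1 *)
Definition nest l (i : nat) (X : seq (int * U)) : U :=
  l ((tot_deg (take i X) + 1, l (take i X)) :: drop i X).

Record Linfty1_algebra W l : Prop := Linfty1Algebra {
  Linfty1_subspace : forall d, GRing.submod_closed (W d);
  Linfty1_degree : forall X, (0 < size X)%N -> homogeneous W X ->
    l X \in W (tot_deg X + 1);
  Linfty1_multilinear : forall X Y d (a : K) x y,
    homogeneous W X -> homogeneous W Y -> x \in W d -> y \in W d ->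
    l (X ++ (d, a *: x + y) :: Y)
      = a *: l (X ++ (d, x) :: Y) + l (X ++ (d, y) :: Y);
  Linfty1_symmetric : forall n (X : n.-tuple (int * U)) (s : 'S_n),
    (0 < n)%N -> homogeneous W X -> l X = koszul X s *: l (permute X s);
  Linfty1_jacobi : forall n (X : n.-tuple (int * U)),
    (0 < n)%N -> homogeneous W X ->
    \sum_(1 <= i < n.+1) \sum_(s : 'S_n | shuffle i s)
       koszul X s *: nest l i (permute X s) = 0
}.

(* The sum [\sum_(k \in D) F k] is the finitely supported sum of the library,
   which is meaningful only when finitely many [F k] are nonzero; this is
   made part of the Maurer-Cartan condition. *)
Definition MC_term l (alpha : U) (k : nat) : U :=
  (k`!%:R)^-1 *: l (nseq k (0, alpha)).

Definition Maurer_Cartan W l (alpha : U) : Prop :=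
  [/\ alpha \in W 0,
      finite_set [set k | (0 < k)%N /\ MC_term l alpha k != 0] &
      \sum_(k \in [set k | (0 < k)%N]) MC_term l alpha k = 0].

Definition twist l (alpha : U) : seq (int * U) -> U := fun X =>
  \sum_(n \in [set: nat]) (n`!%:R)^-1 *: l (nseq n (0, alpha) ++ X).

End LInfinity.

Section Cochains.

Variables (K : fieldType).

(* Hom(V^{(x) n+1}, V) is realised as the space of functions [seq V -> V]
   that are multilinear and vanish on sequences of length other than n+1. *)
Local Notation cochain V := (seq V -> V).

Section Gerstenhaber.

Variable V : lmodType K.

Implicit Types f g : cochain V.

Definition is_hom (n : nat) f : Prop :=
  (forall s1 s2, linear (fun v => f (s1 ++ v :: s2))) /\
  (forall s, size s != n.+1 -> f s = 0).

(* f <> g for |f| = m and |g| = n; the index i is shifted to start at 0. *)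
Definition gdot (m n : nat) f g : cochain V := fun s =>
  \sum_(i < m.+1) (-1) ^+ (i * n) *:
     f (take i s ++ g (take n.+1 (drop i s)) :: drop (i + n.+1) s).

(* The Gerstenhaber bracket on homogeneous cochains [(degree, cochain)]. *)
Definition gbracket (x y : nat * cochain V) : nat * cochain V :=
  ((x.1 + y.1)%N,
   gdot x.1 y.1 x.2 y.2 - (-1) ^+ (x.1 * y.1) *: gdot y.1 x.1 y.2 x.2).

End Gerstenhaber.

Variables (A M : lmodType K).

Local Notation V := (A * M)%type.
Local Notation C := (cochain V).

Definition inA (v : V) : V := (v.1, 0).
Definition inM (v : V) : V := (0, v.2).

(* The restrictions of a cochain to Hom(A^{(x) n+1}, A), to
   Hom(calA^{n,1}, M) and to Hom(M^{(x) n+1}, A), extended by zero; in the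
   second one p is the position of the argument in M. *)
Definition projA (f : C) : C := fun s => inA (f (map inA s)).
Definition projAM (f : C) : C := fun s =>
  \sum_(p < size s)
     inM (f (map inA (take p s) ++ inM s`_p :: map inA (drop p.+1 s))).
Definition projP (f : C) : C := fun s => inA (f (map inM s)).

(* A cochain lies in one of the summands iff it is the extension by zero of
   its restriction. *)
Definition in_Lprime (n : nat) (f : C) : Prop :=
  is_hom n f /\ projA f + projAM f = f.
Definition in_a (n : nat) (f : C) : Prop :=
  is_hom n f /\ projP f = f.

(* L'[1] (+) a, whose elements are pairs (Q[1], theta): the part of degree d
   is L'_{d+1} (+) a_d, where L'_n and a_n are zero for n < 0. *)
Definition graded_total (d : int) : {pred C * C} := fun x =>
  `[< match d with
      | Posz n => in_Lprime n.+1 x.1 /\ in_a n x.2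
      | Negz 0 => in_Lprime 0 x.1 /\ x.2 = 0
      | Negz _.+1 => x.1 = 0 /\ x.2 = 0
      end >].

(* The components of x = (Q[1], theta) of degree d with their degrees in L:
   |Q| = d + 1 and |theta| = d.  The absolute values are harmless, since Q
   (resp. theta) is zero when its degree is negative. *)
Definition Lpart (x : int * (C * C)) : nat * C := (`|(x.1 + 1)%R|%N, x.2.1).
Definition apart (x : int * (C * C)) : nat * C := (`|x.1|%N, x.2.2).

(* The operations, expanded by multilinearity on x_i = (Q_i[1], theta_i) of
   degree d_i.  The component in a is the sum over p of the terms
   l_k (theta_1, ..., Q_p[1], ..., theta_k), computed by moving Q_p[1], of
   degree d_p, to the front with the sign (-1)^(d_p (d_1 + ... + d_(p-1))). *)
Definition Lops (X : seq (int * (C * C))) : C * C :=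
  (if X is [:: x; y] then
     (-1) ^+ (Lpart x).1 *: (gbracket (Lpart x) (Lpart y)).2
   else 0,
   if (2 <= size X)%N then
     \sum_(p < size X) (-1) ^ ((X`_p).1 * tot_deg (take p X)) *:
        projP (foldl (@gbracket V) (Lpart X`_p)
                     (map apart (take p X ++ drop p.+1 X))).2
   else 0).

Definition ext_AA (mu : A -> A -> A) : C := fun s =>
  if s is [:: u; v] then (mu u.1 v.1, 0) else 0.
Definition ext_AM (l : A -> M -> M) : C := fun s =>
  if s is [:: u; v] then (0, l u.1 v.2) else 0.
Definition ext_MA (r : M -> A -> M) : C := fun s =>
  if s is [:: u; v] then (0, r u.2 v.1) else 0.
Definition ext_M (T : M -> A) : C := fun s =>
  if s is [:: u] then (T u.2, 0) else 0.

(* (pi[1], T) with pi = mu + l + r *)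
Definition structure_element (mu : A -> A -> A) (l : A -> M -> M)
    (r : M -> A -> M) (T : M -> A) : C * C :=
  (ext_AA mu + ext_AM l + ext_MA r, ext_M T).

End Cochains.

(* Main.v *)
Require Import Defs.
From mathcomp Require Import all_boot all_order all_algebra all_fingroup.
From mathcomp Require Import boolp classical_sets functions cardinality fsbigop.

(* The operations l_k are Voronov's higher derived brackets. Since a is abelian
   and P[x, y] = P[Px, y] + P[x, Py], expanding [[Q, Q'], theta_1, ..., theta_n]
   by the Leibniz rule and projecting gives
     P[...[[Q, Q'], theta_1], ..., theta_n]
       = sum over I + J of  l(Q, l(Q', theta_I), theta_J)
                          - (+/-) l(Q', l(Q, theta_I), theta_J),
   which is the part in a of the L-infinity identity; the part in L'[1] is the
   Jacobi identity of the Gerstenhaber bracket. All sums are finite because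
   P[...[Q, theta_1], ..., theta_k] = 0 unless k = |Q| + 1.
   A nilpotent L-infinity[1]-algebra can be twisted by any Maurer-Cartan element
   alpha, and beta is Maurer-Cartan for the twist iff alpha + beta is for the
   original structure. Finally (pi[1], T) is Maurer-Cartan iff [pi, pi] = 0 and
   P[[pi, T], T] = 0, which are the axioms of a relative Rota-Baxter algebra. *)

Import GRing.Theory.
Local Open Scope ring_scope.

Set Implicit Arguments.
Unset Strict Implicit.
Unset Printing Implicit Defensive.

(** * Unshuffles of lists with signs *)

(** Signs are the main obstacle. Permutations, shuffles and Koszul products are replaced by
    recursions on lists, [unsh] and [pull], whose signs have Boolean exponents; the shuffles of the
    definition reappear only at the interface, through [sum_shuffle]. Likewise the insertion sum of
    the Gerstenhaber bracket becomes the recursion [circ], suited to induction on the arguments.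

    Inputs and outputs in A and M are counted by derivations instead of combinatorics: bracketing
    with the projections [inA] and [inM], seen as cochains of degree 0, acts by weights. [L'] is the
    kernel of the bracket with [inM], hence a subalgebra by the Jacobi identity, and the vanishing
    of most derived brackets comes from comparing two eigenvalues of the bracket with [inA].
    Characteristic 0 serves to tell these weights apart and to divide by factorials and
    multiplicities.

    In degree 0 the component in [L'] has degree 1, so that operations with more than three
    arguments of degree 0 vanish. This is the origin of the cutoff 4 in the Maurer-Cartan sums. *)

Ltac case_atom t :=
  lazymatch t with
  | addb ?a ?b => first [case_atom a | case_atom b]
  | andb ?a ?b => first [case_atom a | case_atom b]
  | negb ?a => case_atom a
  | true => fail
  | false => fail
  | ?a => case: a
  end.

Ltac bool_ring :=
  repeat (match goal with |- ?a = ?b :> bool => first [case_atom a | case_atom b] end;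
          rewrite ?andbF ?andbT ?addbF ?addbT //=).

(** Products of signs become exclusive ors of their exponents, so that comparing two signs is a
    Boolean identity, settled by case analysis on its atoms. *)
Ltac sgn := rewrite ?scalerA -?signr_addb; congr (_ ^+ nat_of_bool _ *: _); bool_ring.

Section Unshuffles.

Variables (K : fieldType) (E : Type) (p : E -> bool).

Definition par (a : seq E) : bool := foldr (fun x b => p x (+) b) false a.

(* [unsh X F] is the sum of [± F a b] over the ways to split [X] into
   subsequences [a] and [b], with the Koszul sign of [X -> a ++ b]; [p] is the
   parity of the degree. *)
Fixpoint unsh (V : lmodType K) (X : seq E) (F : seq E -> seq E -> V) : V :=
  if X is x :: X' then
    unsh X' (fun a b => F (x :: a) b)
    + unsh X' (fun a b => (-1) ^+ (p x && par a) *: F a (x :: b))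
  else F [::] [::].

(* [pull X F] is the sum of [± F x Y] over the ways to move one entry [x] of [X]
   to the front of the remaining ones. *)
Fixpoint pull (V : lmodType K) (X : seq E) (F : E -> seq E -> V) : V :=
  if X is x :: X' then
    F x X' + pull X' (fun y Y => (-1) ^+ (p x && p y) *: F y (x :: Y))
  else 0.

Section OneSpace.
Variable V : lmodType K.
Implicit Types (X : seq E) (F G : seq E -> seq E -> V) (f g : E -> seq E -> V).

Lemma eq_unsh_all (P : pred E) X F G : all P X ->
  (forall a b, all P a -> all P b -> (size a + size b = size X)%N ->
     F a b = G a b) ->
  unsh X F = unsh X G.
Proof.
elim: X F G => [|x X IH] F G /=; first by move=> _; apply.
case/andP=> Px PX FG; congr (_ + _); apply: IH => // a b Pa Pb sab.
  by apply: FG => //=; rewrite ?Px // addSn sab.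
by congr (_ *: _); apply: FG => //=; rewrite ?Px // addnS sab.
Qed.

Lemma eq_unsh X F G : (forall a b, F a b = G a b) -> unsh X F = unsh X G.
Proof.
move=> FG; apply: (eq_unsh_all (P := predT)) => [|a b _ _ _]; last exact: FG.
exact: all_predT.
Qed.

Lemma eq_pull_all (P : pred E) X f g : all P X ->
  (forall y Y, P y -> all P Y -> (size X = (size Y).+1)%N ->
     par X = p y (+) par Y -> f y Y = g y Y) ->
  pull X f = pull X g.
Proof.
elim: X f g => [|x X IH] f g //= /andP[Px PX] fg; congr (_ + _).
  exact: fg.
apply: IH => // y Y Py PY sY pY; congr (_ *: _); apply: fg => //=.
- by rewrite Px.
- by rewrite sY.
- by rewrite pY addbCA.
Qed.

Lemma eq_pull X f g : (forall y Y, f y Y = g y Y) -> pull X f = pull X g.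
Proof.
move=> fg; apply: (eq_pull_all (P := predT)) => [|a b _ _ _ _]; last exact: fg.
exact: all_predT.
Qed.

Lemma unsh_lin (c : K) X F G :
  unsh X (fun a b => c *: F a b + G a b) = c *: unsh X F + unsh X G.
Proof.
elim: X F G => [|x X IH] F G //=.
rewrite IH scalerDr addrACA; congr (_ + _); rewrite -IH.
by apply: eq_unsh => a b; rewrite scalerDr !scalerA mulrC.
Qed.

Lemma unsh0 X : unsh X (fun _ _ => 0 : V) = 0.
Proof.
have h := unsh_lin (-1) X (fun _ _ => 0) (fun _ _ => 0).
rewrite -[RHS](addNr (unsh X (fun _ _ => 0))) -scaleN1r -h.
by apply: eq_unsh => a b; rewrite scaler0 addr0.
Qed.

Lemma unshZ (c : K) X F : unsh X (fun a b => c *: F a b) = c *: unsh X F.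
Proof.
by rewrite -[RHS]addr0 -(unsh0 X) -unsh_lin; apply: eq_unsh => a b; rewrite addr0.
Qed.

Lemma unshD X F G : unsh X (fun a b => F a b + G a b) = unsh X F + unsh X G.
Proof.
by rewrite -[unsh X F]scale1r -unsh_lin; apply: eq_unsh => a b; rewrite scale1r.
Qed.

Lemma unsh_sum (I : Type) (r : seq I) (P : pred I) X (F : I -> seq E -> seq E -> V) :
  unsh X (fun a b => \sum_(i <- r | P i) F i a b) = \sum_(i <- r | P i) unsh X (F i).
Proof.
elim: r => [|i r IH].
  by rewrite big_nil -[RHS](unsh0 X); apply: eq_unsh => a b; rewrite big_nil.
rewrite big_cons; case: ifP => Pi; last first.
  by rewrite -IH; apply: eq_unsh => a b; rewrite big_cons Pi.
by rewrite -IH -unshD; apply: eq_unsh => a b; rewrite big_cons Pi.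
Qed.

Lemma pull_lin (c : K) X f g :
  pull X (fun y Y => c *: f y Y + g y Y) = c *: pull X f + pull X g.
Proof.
elim: X f g => [|x X IH] f g /=; first by rewrite scaler0 addr0.
rewrite scalerDr addrACA; congr (_ + _); rewrite -IH.
by apply: eq_pull => a b; rewrite scalerDr !scalerA mulrC.
Qed.

Lemma pull0 X : pull X (fun _ _ => 0 : V) = 0.
Proof.
have h := pull_lin (-1) X (fun _ _ => 0) (fun _ _ => 0).
rewrite -[RHS](addNr (pull X (fun _ _ => 0))) -scaleN1r -h.
by apply: eq_pull => a b; rewrite scaler0 addr0.
Qed.

Lemma pullZ (c : K) X f : pull X (fun a b => c *: f a b) = c *: pull X f.
Proof.
by rewrite -[RHS]addr0 -(pull0 X) -pull_lin; apply: eq_pull => a b; rewrite addr0.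
Qed.

Lemma pullD X f g : pull X (fun a b => f a b + g a b) = pull X f + pull X g.
Proof.
by rewrite -[pull X f]scale1r -pull_lin; apply: eq_pull => a b; rewrite scale1r.
Qed.

Lemma unsh_nil X (G : seq E -> V) :
  unsh X (fun a b => if a is [::] then G b else 0) = G X.
Proof.
elim: X G => [|x X IH] G //=; rewrite unsh0 add0r -(IH (fun b => G (x :: b))).
by apply: eq_unsh => -[|y a] b /=; rewrite ?andbF ?scale1r // scaler0.
Qed.

Lemma unsh_single X f :
  unsh X (fun a b => if a is [:: x] then f x b else 0) = pull X f.
Proof.
elim: X f => [|x X IH] f //=; rewrite -[f x X](unsh_nil X (f x)); congr (_ + _).
rewrite -IH; apply: eq_unsh => -[|y [|z a]] b /=; rewrite ?scaler0 //.
by rewrite addbF.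
Qed.

Lemma unsh3 x y z F :
  F [:: x; y; z] [::] = 0 -> F [:: x] [:: y; z] = 0 -> F [:: y] [:: x; z] = 0 ->
  F [:: z] [:: x; y] = 0 -> F [::] [:: x; y; z] = 0 ->
  unsh [:: x; y; z] F = F [:: x; y] [:: z] + (-1) ^+ (p y && p z) *: F [:: x; z] [:: y]
    + (-1) ^+ (p x && (p y (+) p z)) *: F [:: y; z] [:: x].
Proof.
move=> F1 F2 F3 F4 F5; rewrite /= F1 F2 F3 F4 F5 !scaler0 !addr0 !add0r !andbF !addbF.
by rewrite !scale1r.
Qed.

(** Two entries pulled one after the other form a pair of entries taken in either order; the sign is
    that of the exchange. In the Jacobi identity this matches the nested brackets with the terms in
    which the inner operation has two arguments. *)
Lemma unsh_pair X (S : E -> E -> seq E -> V) :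
  unsh X (fun a b => if a is [:: x; y]
                     then S x y b + (-1) ^+ (p x && p y) *: S y x b else 0)
  = pull X (fun x Y => pull Y (S x)).
Proof.
elim: X S => [|x X IH] S //=.
transitivity (pull X (S x) + (pull X (fun y Y => (-1) ^+ (p x && p y) *: S y x Y)
   + pull X (fun y Y => pull Y (fun z Z =>
       (-1) ^+ (p x && (p y (+) p z)) *: S y z (x :: Z))))); last first.
  congr (_ + _); rewrite -pullD; apply: eq_pull => y Y.
  rewrite scalerDr -pullZ; congr (_ + _); apply: eq_pull => z Z; sgn.
rewrite addrA -(IH (fun y z Z => (-1) ^+ (p x && (p y (+) p z)) *: S y z (x :: Z))).
rewrite -pullD -unsh_single; congr (_ + _).
apply: eq_unsh => -[|y [|z [|t a]]] b /=; rewrite ?scaler0 ?addbF //.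
by rewrite scalerDr; congr (_ + _); sgn.
Qed.

(** Coassociativity of unshuffling: both sides split [X] into [a], [y] and [b], and on the right [y]
    has to jump back over [a]. *)
Lemma unsh_pullr X (H : seq E -> E -> seq E -> V) :
  unsh X (fun a b => pull b (H a))
  = pull X (fun y Y => unsh Y (fun a b => (-1) ^+ (p y && par a) *: H a y b)).
Proof.
elim: X H => [|x X IH] H //=.
rewrite IH.
transitivity (unsh X (fun a b => (-1) ^+ (p x && par a) *: H a x b) +
   (pull X (fun y Y => unsh Y (fun a b => (-1) ^+ (p y && par a) *: H (x :: a) y b))
  + pull X (fun y Y => unsh Y (fun a b =>
       (-1) ^+ (p y && par a) *: ((-1) ^+ (p x && (par a (+) p y)) *: H a y (x :: b)))))).
  rewrite addrCA; congr (_ + _); rewrite -IH -unshD; apply: eq_unsh => a b.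
  rewrite scalerDr -pullZ; congr (_ + _); apply: eq_pull => y Y; sgn.
congr (_ + _); rewrite -pullD; apply: eq_pull => y Y.
rewrite scalerDr -!unshZ; congr (_ + _); apply: eq_unsh => a b; sgn.
Qed.

(** The same coassociativity; here the pulled entry ends up in front of everything on both sides, so
    no sign appears. *)
Lemma unsh_pulll X (H : seq E -> E -> seq E -> V) :
  unsh X (fun a b => pull a (H b))
  = pull X (fun z Z => unsh Z (fun a b => H b z a)).
Proof.
elim: X H => [|x X IH] H //=.
rewrite unshD -addrA; congr (_ + _).
rewrite IH.
transitivity (pull X (fun z Z =>
  (-1) ^+ (p x && p z) *: unsh Z (fun a b => H b z (x :: a)) +
  (-1) ^+ (p x && p z) *: unsh Z (fun a b => (-1) ^+ (p x && par a) *: H (x :: b) z a))).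
  rewrite pullD; congr (_ + _).
    by apply: eq_pull => z Z; rewrite unshZ.
  transitivity (unsh X (fun a b => pull a (fun z Z =>
     (-1) ^+ (p x && (p z (+) par Z)) *: H (x :: b) z Z))).
    apply: eq_unsh => a b; rewrite -pullZ.
    apply: (eq_pull_all (P := predT)) => [|z Z _ _ _ ->]; first exact: all_predT.
    sgn.
  rewrite IH; apply: eq_pull => z Z; rewrite -unshZ; apply: eq_unsh => a b; sgn.
by apply: eq_pull => z Z; rewrite -scalerDr.
Qed.

(** Graded cocommutativity of unshuffling. *)
Lemma unsh_swap X F :
  unsh X (fun a b => (-1) ^+ (par a && par b) *: F b a) = unsh X F.
Proof.
elim: X F => [|x X IH] F /=; first by rewrite scale1r.
rewrite addrC -[unsh X (fun a b => F (x :: a) b)]IH.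
rewrite -[unsh X (fun a b => _ *: F a (x :: b))]IH.
by congr (_ + _); apply: eq_unsh => a b; sgn.
Qed.

(** The terms pulling [x] and [y] trade places, and every other term is governed by the symmetry of
    [f] in its remaining arguments. *)
Lemma pull_swap (P : pred E) X x y Y f : all P X -> P x -> P y -> all P Y ->
  (forall z Z Z', P z -> all P Z -> all P Z' ->
     f z (Z ++ x :: y :: Z') = (-1) ^+ (p x && p y) *: f z (Z ++ y :: x :: Z')) ->
  pull (X ++ x :: y :: Y) f = (-1) ^+ (p x && p y) *: pull (X ++ y :: x :: Y) f.
Proof.
move=> + Px Py PY; elim: X f => [|w X IH] f /= => [_ fS|/andP[Pw PX] fS].
  rewrite !scalerDr [RHS]addrCA; congr (_ + (_ + _)).
    by rewrite scalerA -signr_addb andbC addbb scale1r.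
  rewrite -!pullZ; apply: (eq_pull_all PY) => z Z Pz PZ _ _.
  rewrite (fS z [::]) //=; sgn.
rewrite scalerDr fS //; congr (_ + _).
rewrite IH // => z Z Z' Pz PZ PZ'; rewrite (fS z (w :: Z)) //=; last by rewrite Pw.
sgn.
Qed.

Lemma pull_multilinear (P : pred E) (c : K) X x y z Y f :
  p x = p z -> p y = p z -> all P X -> all P Y ->
  (forall Z, all P Z -> f z Z = c *: f x Z + f y Z) ->
  (forall w Z Z', P w -> all P Z -> all P Z' ->
     f w (Z ++ z :: Z') = c *: f w (Z ++ x :: Z') + f w (Z ++ y :: Z')) ->
  pull (X ++ z :: Y) f = c *: pull (X ++ x :: Y) f + pull (X ++ y :: Y) f.
Proof.
move=> px py + PY; elim: X f => [|w X IH] f /= => [_ f1 f2|/andP[Pw PX] f1 f2].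
  rewrite f1 // scalerDr addrACA; congr (_ + _); rewrite -pullZ -pullD.
  apply: (eq_pull_all PY) => v Z Pv PZ _ _.
  by rewrite (f2 v [::]) // px py scalerDr !scalerA mulrC.
rewrite f2 // scalerDr addrACA; congr (_ + _); apply: IH => // [Z PZ|v Z Z' Pv PZ PZ'].
  by rewrite f1 /= ?Pw // px py scalerDr !scalerA mulrC.
by rewrite (f2 v (w :: Z)) /= ?Pw // scalerDr !scalerA mulrC.
Qed.

Lemma pull_nth (e : E) X f : pull X f = \sum_(i < size X)
  (-1) ^+ (p (nth e X i) && par (take i X)) *: f (nth e X i) (take i X ++ drop i.+1 X).
Proof.
elim: X f => [|x X IH] f /=; first by rewrite big_ord0.
rewrite big_ord_recl /= andbF scale1r drop0 IH; congr (_ + _).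
by apply: eq_bigr => i _ /=; sgn.
Qed.

End OneSpace.

Section Morphism.
Variables (V V' : lmodType K) (h : V -> V').
Hypothesis h_lin : linear h.

Let h0 : h 0 = 0.
Proof. by have := h_lin (-1) 0 0; rewrite scaler0 addr0 scaleN1r addNr. Qed.
Let hZ c u : h (c *: u) = c *: h u.
Proof. by have := h_lin c u 0; rewrite h0 !addr0. Qed.
Let hD u v : h (u + v) = h u + h v.
Proof. by have := h_lin 1 u v; rewrite !scale1r. Qed.

Lemma unsh_morph X F : h (unsh X F) = unsh X (fun a b => h (F a b)).
Proof.
elim: X F => [|x X IH] F //=; rewrite hD !IH; congr (_ + _).
by apply: eq_unsh => a b; rewrite hZ.
Qed.

Lemma pull_morph X f : h (pull X f) = pull X (fun y Y => h (f y Y)).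
Proof.
elim: X f => [|x X IH] f //=; rewrite hD !IH; congr (_ + _).
by apply: eq_pull => a b; rewrite hZ.
Qed.

End Morphism.

Section Symmetric.
Variables (V : lmodType K) (P : pred E).

(** Adjacent transpositions are what inductions on lists produce; [symmetric_perm] recovers
    arbitrary permutations. *)
Definition symmetric_on (L : seq E -> V) :=
  forall X x y Y, all P X -> P x -> P y -> all P Y ->
    L (X ++ x :: y :: Y) = (-1) ^+ (p x && p y) *: L (X ++ y :: x :: Y).

Lemma symmetric_cons L x : P x -> symmetric_on L ->
  symmetric_on (fun Y => L (x :: Y)).
Proof. by move=> Px Ls X y z Y PX *; apply: (Ls (x :: X)) => //=; rewrite Px. Qed.

Lemma symmetric_move L X x Y : symmetric_on L -> all P X -> P x -> all P Y ->
  L (X ++ x :: Y) = (-1) ^+ (p x && par X) *: L (x :: X ++ Y).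
Proof.
move=> Ls + Px PY; elim: X L Ls => [|y X IH] L Ls /=; first by rewrite andbF scale1r.
case/andP=> Py PX; rewrite (IH (fun Z => L (y :: Z))) //; last exact: symmetric_cons.
rewrite (Ls [::] y x) ?all_cat ?PX //=; sgn.
Qed.

End Symmetric.

End Unshuffles.

Lemma unsh_map (K : fieldType) (E E' : Type) (p : E -> bool) (p' : E' -> bool) (h : E -> E')
    (V : lmodType K) X (F : seq E' -> seq E' -> V) : (forall x, p' (h x) = p x) ->
  unsh p' (map h X) F = unsh p X (fun a b => F (map h a) (map h b)).
Proof.
move=> hp; have par_map a : par p' (map h a) = par p a.
  by elim: a => //= x a ->; rewrite hp.
elim: X F => [|x X IH] F //=; rewrite !IH; congr (_ + _).
by apply: eq_unsh => a b; rewrite hp par_map.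
Qed.

(** * Koszul signs of permutations compared with the signs of unshuffles *)

Section Koszul.

Variables (K : fieldType) (E : Type) (p : E -> bool) (I : eqType) (lt : rel I) (x : I -> E).
Hypotheses (lt_irr : irreflexive lt) (lt_trans : transitive lt).

(* The Koszul sign of sorting [i :: w] is the product over the pairs in [w] and
   over the [j] of [w] that have to jump over [i]. *)
Definition inversion_parity (i : I) (w : seq I) : bool :=
  \big[addb/false]_(j <- w | lt j i) (p (x i) && p (x j)).

Fixpoint koszul_parity (w : seq I) : bool :=
  if w is i :: w' then inversion_parity i w' (+) koszul_parity w' else false.

Fixpoint unshuffle_parity (m : bitseq) (X : seq E) : bool :=
  match m, X with
  | b :: m', y :: X' => (~~ b && p y && par p (mask m' X')) (+) unshuffle_parity m' X'
  | _, _ => false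
  end.

Lemma inversion_parity_gt i w : all (lt i) w -> inversion_parity i w = false.
Proof.
move=> iw; rewrite /inversion_parity big_seq_cond big1 // => j /andP[/(allP iw) ij ji].
by have := lt_trans ij ji; rewrite lt_irr.
Qed.

Lemma inversion_parity_lt i w : all (lt^~ i) w ->
  inversion_parity i w = p (x i) && par p (map x w).
Proof.
rewrite /inversion_parity; elim: w => [|j w IH] /=; first by rewrite big_nil andbF.
by case/andP=> ji iw; rewrite big_cons ji IH //; bool_ring.
Qed.

Lemma inversion_parity_cat i v w :
  inversion_parity i (v ++ w) = inversion_parity i v (+) inversion_parity i w.
Proof. exact: big_cat. Qed.

Lemma inversion_parity_perm i v w : perm_eq v w -> inversion_parity i v = inversion_parity i w.
Proof. exact: perm_big. Qed.

Lemma koszul_parity_min v i w : all (lt i) v -> all (lt i) w ->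
  koszul_parity (v ++ i :: w) = (par p (map x v) && p (x i)) (+) koszul_parity (v ++ w).
Proof.
elim: v => [|j v IH] /= => [_ iw|/andP[ij iv] iw]; first by rewrite inversion_parity_gt.
by rewrite IH // !inversion_parity_cat /inversion_parity big_cons ij; bool_ring.
Qed.

(** The inversions of the concatenation are the pairs of an unselected entry and a later selected
    one, which is exactly what the sign in [unsh] records. *)
Lemma koszul_parity_mask m e : pairwise lt e -> size m = size e ->
  koszul_parity (mask m e ++ mask (map negb m) e) = unshuffle_parity m (map x e).
Proof.
elim: e m => [|i e IH] [|b m] //= /andP[ie e_s] [/(IH _ e_s) <-].
have ms m' : all (lt i) (mask m' e) by apply/allP => j /mem_mask; apply: (allP ie).
case: b => /=; first by rewrite inversion_parity_gt // all_cat !ms.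
by rewrite koszul_parity_min // -map_mask andbC.
Qed.

(** Insertion sort read backwards: the head of [w] is moved from its place in the sorted [v] to the
    front, crossing precisely the smaller indices, that is, the entries with which it forms an
    inversion in [w]. *)
Lemma symmetric_perm (V : lmodType K) (P : pred E) (L : seq E -> V) v w :
  symmetric_on p P L -> (forall i, P (x i)) -> pairwise lt v -> perm_eq w v ->
  L (map x v) = (-1) ^+ koszul_parity w *: L (map x w).
Proof.
move=> + Px; elim: w v L => [|i w IH] v L Ls v_s wv.
  by move: wv; rewrite perm_sym => /perm_nilP ->; rewrite scale1r.
have iv : i \in v by rewrite -(perm_mem wv) mem_head.
case/splitPr: v / iv => v1 v2 in v_s wv *.
have wv12 : perm_eq w (v1 ++ v2).
  by rewrite -(perm_cons i) (permPl wv) perm_catC /= perm_cons perm_catC.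
move: v_s; rewrite pairwise_cat /= => /and3P[v12 v1_s /andP[iv2 v2_s]].
have v1i : all (lt^~ i) v1.
  by apply/allP => j jv1; move: v12 => /allrelP; apply=> //; rewrite mem_head.
have v12_s : pairwise lt (v1 ++ v2).
  rewrite pairwise_cat v1_s v2_s !andbT; apply/allrelP => j k jv kv.
  by move/allrelP: v12; apply=> //; rewrite inE kv orbT.
have allP_ u : all P (map x u) by elim: u => //= j u ->; rewrite Px.
rewrite map_cat /= (symmetric_move Ls) // -map_cat.
rewrite (IH _ (fun Y => L (x i :: Y)) (symmetric_cons (Px i) Ls) v12_s wv12) /=.
rewrite (inversion_parity_perm i wv12) inversion_parity_cat.
rewrite (inversion_parity_lt v1i) (inversion_parity_gt iv2); sgn.
Qed.

End Koszul.

(** The choices made by [unsh], listed in the order of its recursion. Masks are the common index set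
    of [unsh] and of the shuffles. *)
Fixpoint masks (n : nat) : seq bitseq :=
  if n is n'.+1 then map (cons true) (masks n') ++ map (cons false) (masks n')
  else [:: [::]].

Lemma mem_masks n m : (m \in masks n) = (size m == n).
Proof.
elim: n m => [|n IH] m /=; first by rewrite inE; case: m.
rewrite mem_cat; case: m => [|b m].
  by apply/negbTE; rewrite negb_or; apply/andP; split; apply/mapP => -[].
rewrite eqSS -IH; case: b; rewrite mem_map; last by move=> ? ? [].
  by rewrite orbC; case: mapP => // -[? ? []].
all: try by case: mapP => // -[? ? []].
by move=> ? ? [].
Qed.

Lemma masks_uniq n : uniq (masks n).
Proof.
elim: n => //= n IH; rewrite cat_uniq !map_inj_uniq ?IH //; try by move=> ? ? [].
by rewrite andbT; apply/hasPn => _ /mapP[m _ ->]; apply/mapP => -[].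
Qed.

Lemma unsh_masks (K : fieldType) (E : Type) (p : E -> bool) (V : lmodType K)
    (X : seq E) (F : seq E -> seq E -> V) :
  unsh p X F = \sum_(m <- masks (size X))
     (-1) ^+ unshuffle_parity p m X *: F (mask m X) (mask (map negb m) X).
Proof.
elim: X F => [|x X IH] F /=; first by rewrite big_seq1 scale1r.
rewrite big_cat !big_map !IH; congr (_ + _); apply: eq_bigr => m _ //=.
by sgn.
Qed.

Lemma perm_mask_cat (T : eqType) (m : bitseq) (e : seq T) : size m = size e ->
  perm_eq (mask m e ++ mask (map negb m) e) e.
Proof.
elim: e m => [|i e IH] [|[] m] //= [/IH me]; first by rewrite perm_cons.
by rewrite perm_catC /= perm_cons perm_catC.
Qed.

(** * Unshuffles as permutations *)

Lemma expN1_absz (K : fieldType) (d : int) : (-1 : K) ^ d = (-1) ^+ odd `|d|%N.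
Proof.
rewrite signr_odd; case: d => n; first by rewrite exprnP.
by rewrite NegzE -exprnN abszN /= -signr_odd invr_sign signr_odd.
Qed.

Lemma expN1_mulz (K : fieldType) (d e : int) :
  (-1 : K) ^ (d * e) = (-1) ^+ (odd `|d|%N && odd `|e|%N).
Proof. by rewrite expN1_absz abszM oddM. Qed.

Lemma odd_abszD (d e : int) : odd `|(d + e)%R|%N = odd `|d|%N (+) odd `|e|%N.
Proof.
(* The parity is read off from [(-1) ^ (d + e)] in [rat], where the exponent law holds and [-1]
   differs from [1]. *)
have /eqP := expN1_absz rat (d + e).
rewrite expfzDr // !expN1_absz -signr_addb.
by case: (odd `|d|) (odd `|e|) (odd `|(d + e)%R|) => -[] [] //=.
Qed.

Section PermutationLists.

Variables (n : nat).
Implicit Types (s : 'S_n) (w : seq 'I_n).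

Definition ord_lt : rel 'I_n := fun a b => (a < b)%N.

Lemma ord_lt_irr : irreflexive ord_lt. Proof. by move=> a; rewrite /ord_lt ltnn. Qed.
Lemma ord_lt_trans : transitive ord_lt. Proof. by move=> a b c; apply: ltn_trans. Qed.

Definition perm_list s : seq 'I_n := [seq s a | a <- enum 'I_n].

Lemma enum_ord_pairwise : pairwise ord_lt (enum 'I_n).
Proof.
have /= := pairwise_map (val : 'I_n -> nat) ltn (enum 'I_n).
rewrite val_enum_ord -(sorted_pairwise ltn_trans) iota_ltn_sorted => h.
exact: esym h.
Qed.

Lemma perm_list_perm s : perm_eq (perm_list s) (enum 'I_n).
Proof.
apply: uniq_perm; rewrite ?(map_inj_uniq perm_inj) ?enum_uniq // => i.
by rewrite mem_enum; apply/mapP; exists (s^-1 i)%g; rewrite ?mem_enum ?permKV.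
Qed.

Lemma nth_perm_list s (a b : 'I_n) : nth b (perm_list s) a = s a.
Proof. by rewrite (nth_map a) ?size_enum_ord //; congr (s _); apply: nth_ord_enum. Qed.

Lemma perm_list_inj : injective perm_list.
Proof.
by move=> s t st; apply/permP => a; rewrite -(nth_perm_list s a a) st nth_perm_list.
Qed.

Lemma perm_list_surj w : perm_eq w (enum 'I_n) -> exists s, perm_list s = w.
Proof.
move=> we; have sw : size w = n by rewrite (perm_size we) size_enum_ord.
have uw : uniq w by rewrite (perm_uniq we) enum_uniq.
(* The default [a] is taken from the argument, since ['I_n] may be empty. *)
have inj : injective (fun a : 'I_n => nth a w a).
  move=> a b; rewrite (set_nth_default b a) ?sw // => /eqP.
  by rewrite nth_uniq ?sw // => /eqP/val_inj.
exists (perm inj).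
have sz : size (perm_list (perm inj)) = size w by rewrite size_map size_enum_ord sw.
case: w => [|i0 w'] in we sw uw inj sz *; first by apply/nilP; rewrite /nilp sz.
apply: (eq_from_nth (x0 := i0) sz) => a; rewrite sz sw => an.
rewrite (nth_perm_list _ (Ordinal an)) permE /=.
by apply: set_nth_default; rewrite sw.
Qed.

Definition unshuffled i w :=
  [&& perm_eq w (enum 'I_n), pairwise ord_lt (take i w) & pairwise ord_lt (drop i w)].

Lemma shuffle_unshuffled i s : shuffle i s = unshuffled i (perm_list s).
Proof.
have pE := enum_ord_pairwise.
rewrite /unshuffled perm_list_perm /= /perm_list -map_take -map_drop !pairwise_map.
apply/idP/andP => [/forallP sh | [s1 s2]].
  have {}sh (a b : 'I_n) : (a < b)%N -> (b < i)%N || (i <= a)%N -> ord_lt (s a) (s b).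
    by move=> ab bi; have /forallP/(_ b)/implyP := sh a; apply; rewrite ab.
  have in_take : all (fun a : 'I_n => a < i)%N (take i (enum 'I_n)).
    rewrite -(all_map val (fun a => a < i)%N) map_take val_enum_ord take_iota.
    by apply/allP => j; rewrite mem_iota add0n leq_min => /and3P[].
  have in_drop : all (fun a : 'I_n => i <= a)%N (drop i (enum 'I_n)).
    rewrite -(all_map val (fun a => i <= a)%N) map_drop val_enum_ord drop_iota.
    by apply/allP => j; rewrite mem_iota add0n => /andP[].
  move: pE; rewrite -{1}(cat_take_drop i (enum 'I_n)) pairwise_cat => /and3P[_ pE1 pE2].
  split.
    apply: sub_in_pairwise in_take pE1 => a b ai bi ab.
    by apply: sh => //; apply/orP; left; apply: bi.
  apply: sub_in_pairwise in_drop pE2 => a b ai bi ab.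
  by apply: sh => //; apply/orP; right; apply: ai.
apply/forallP => a; apply/forallP => b; apply/implyP => /andP[ab /orP[bi|ia]].
  have bt : (b < size (take i (enum 'I_n)))%N by rewrite size_take size_enum_ord; case: ifP.
  have := pairwiseP a s1 _ _ (ltn_trans ab bt) bt ab.
  by rewrite /= !nth_take ?nth_ord_enum // (ltn_trans ab).
have ib := leq_trans ia (ltnW ab).
have lt_drop (c : 'I_n) : (i <= c -> c - i < size (drop i (enum 'I_n)))%N.
  by move=> ic; rewrite size_drop size_enum_ord ltn_sub2r // (leq_ltn_trans ic).
have := pairwiseP a s2 _ _ (lt_drop a ia) (lt_drop b ib) (ltn_sub2r (leq_ltn_trans ia ab) ab).
by rewrite /= !nth_drop !subnKC // !nth_ord_enum.
Qed.

(** Both halves being increasing, [w] is determined by the set of its first [i] entries; the mask is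
    the indicator of that set. *)
Lemma unshuffledP i w : (i <= n)%N ->
  unshuffled i w <-> exists2 m, (size m == n) && (count id m == i)
     & w = mask m (enum 'I_n) ++ mask (map negb m) (enum 'I_n).
Proof.
have pE := enum_ord_pairwise; have sE := size_enum_ord n.
move=> le_in; split => [/and3P[we w1 w2]|[m /andP[/eqP sm /eqP cm] ->]]; last first.
  rewrite /unshuffled perm_mask_cat ?sm ?sE //.
  have sz : size (mask m (enum 'I_n)) = i by rewrite size_mask ?sm.
  by rewrite -[X in take X]sz -[X in drop X]sz take_size_cat ?drop_size_cat ?pairwise_mask.
have uw : uniq w by rewrite (perm_uniq we) enum_uniq.
have filterE (v : seq 'I_n) : pairwise ord_lt v -> [seq j <- enum 'I_n | j \in v] = v.
  move=> v_s; apply: (irr_sorted_eq ord_lt_trans ord_lt_irr).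
  - exact: pairwise_sorted (pairwise_filter _ pE).
  - exact: pairwise_sorted.
  by move=> j; rewrite mem_filter mem_enum andbT.
have negE : [seq ~~ (j \in take i w) | j <- enum 'I_n] = [seq j \in drop i w | j <- enum 'I_n].
  apply: eq_map => j; have := uw; rewrite -{1}(cat_take_drop i w) cat_uniq.
  move=> /and3P[_ /hasPn dis _]; have := perm_mem we j.
  rewrite mem_enum -{1}(cat_take_drop i w) mem_cat.
  by case: (boolP (j \in drop i w)) => [/dis -> //|_]; rewrite orbF => ->.
exists [seq j \in take i w | j <- enum 'I_n].
  rewrite size_map sE eqxx /= count_map -size_filter.
  rewrite (@eq_filter _ _ (mem (take i w))) // filterE // size_takel //.
  by rewrite (perm_size we) sE.
have -> : map negb [seq j \in take i w | j <- enum 'I_n]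
    = [seq j \in drop i w | j <- enum 'I_n].
  by rewrite -negE -map_comp.
by rewrite -!filter_mask !filterE // cat_take_drop.
Qed.

End PermutationLists.

Lemma mask_inj (T : eqType) (e : seq T) m m' : uniq e ->
  size m = size e -> size m' = size e -> mask m e = mask m' e -> m = m'.
Proof.
elim: e m m' => [|i e IH] [|b m] [|b' m'] //= /andP[ie ue] [sm] [sm'].
have nm k : i \notin mask k e by apply: contra ie; apply: mem_mask.
case: b b' => -[] /=; last by move/IH => ->.
- by move=> [/IH ->].
- by move=> mm; have := nm m'; rewrite -mm mem_head.
- by move=> mm; have := nm m; rewrite mm mem_head.
Qed.

Section PermutationSums.

Variables (K : fieldType) (E : Type) (p : E -> bool) (V : lmodType K).
Variables (n : nat) (X : n.-tuple E).

Definition perm_seq (s : 'S_n) : seq E := map (tnth X) (perm_list s).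

(** The bridge from the shuffles of the definition to [unsh]: both sides are reindexed by the masks
    that select [i] entries, with signs matched by [koszul_parity_mask]. *)
Lemma sum_shuffle (i : nat) (F : seq E -> V) : (i <= n)%N ->
  \sum_(s : 'S_n | shuffle i s)
     (-1) ^+ koszul_parity p (@ord_lt n) (tnth X) (perm_list s) *: F (perm_seq s)
  = unsh p X (fun a b => if size a == i then F (a ++ b) else 0).
Proof.
move=> le_in.
pose G (w : seq 'I_n) := (-1) ^+ koszul_parity p (@ord_lt n) (tnth X) w *: F (map (tnth X) w).
pose W m := mask m (enum 'I_n) ++ mask (map negb m) (enum 'I_n).
have XE : map (tnth X) (enum 'I_n) = X := map_tnth_enum X.
have sE := size_enum_ord n.
have mW m : m \in masks n -> count id m == i -> take i (W m) = mask m (enum 'I_n).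
  rewrite mem_masks => /eqP sm /eqP <-.
  by rewrite -(@size_mask _ _ (enum 'I_n)) ?take_size_cat // sE.
transitivity (\sum_(w <- [seq W m | m <- masks n & count id m == i]) G w).
  rewrite -big_filter -(big_map (@perm_list n) predT G).
  apply: perm_big; apply: uniq_perm.
  - by rewrite (map_inj_uniq (@perm_list_inj n)) filter_uniq // index_enum_uniq.
  - rewrite map_inj_in_uniq ?filter_uniq ?masks_uniq // => m m'.
    rewrite !mem_filter => /andP[cm mm] /andP[cm' mm'] WW.
    move: (mm) (mm'); rewrite !mem_masks => /eqP sm /eqP sm'.
    apply: (mask_inj (enum_uniq 'I_n)); rewrite ?sE //.
    by rewrite -(mW _ mm cm) -(mW _ mm' cm') WW.
  move=> w; apply/mapP/mapP => [[s]|[m]].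
    rewrite mem_filter => /andP[+ _] ->; rewrite shuffle_unshuffled => /(unshuffledP _ le_in).
    by case=> m /andP[sm cm] ->; exists m; rewrite // mem_filter mem_masks cm sm.
  rewrite mem_filter mem_masks => /andP[cm sm] ->.
  have uw : unshuffled i (W m) by apply/(unshuffledP _ le_in); exists m; rewrite ?sm ?cm.
  have /and3P[/perm_list_surj[s sW] _ _] := uw.
  by exists s => //; rewrite mem_filter mem_index_enum andbT shuffle_unshuffled sW.
rewrite unsh_masks size_tuple big_map big_filter [RHS]big_mkcond /= big_mkcond /=.
rewrite !big_seq; apply: eq_bigr => m; rewrite mem_masks => /eqP sm.
rewrite size_mask ?size_tuple //; case: ifP => _; last by rewrite scaler0.
rewrite /G /W koszul_parity_mask ?sE ?enum_ord_pairwise // ?XE; last exact: ord_lt_trans.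
  by rewrite map_cat !map_mask XE.
exact: ord_lt_irr.
Qed.

End PermutationSums.

Section LinftyLists.

Variables (K : fieldType) (U : lmodType K).
Implicit Types (X : seq (int * U)).

Definition odd_deg (x : int * U) : bool := odd `|x.1|%N.

Lemma par_tot_deg X : par odd_deg X = odd `|tot_deg X|%N.
Proof.
rewrite /tot_deg; elim: X => [|x X IH] /=; first by rewrite big_nil.
by rewrite big_cons odd_abszD -IH.
Qed.

(** A congruence that remembers the integer degree: an inner result is fed into an outer bracket
    together with its degree, which the parity kept by [eq_pull_all] does not determine. *)
Lemma eq_pull_tot (V : lmodType K) (P : pred (int * U)) X f g : all P X ->
  (forall y Y, P y -> all P Y -> tot_deg X = y.1 + tot_deg Y -> f y Y = g y Y :> V) ->
  pull odd_deg X f = pull odd_deg X g.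
Proof.
have tot_cons (x : int * U) Z : tot_deg (x :: Z) = x.1 + tot_deg Z.
  by rewrite /tot_deg big_cons.
elim: X f g => [|x X IH] f g //= /andP[Px PX] fg; congr (_ + _).
  by apply: fg => //; rewrite tot_cons.
apply: IH => // y Y Py PY tX; congr (_ *: _); apply: fg => //=; first by rewrite Px.
by rewrite !tot_cons tX addrCA.
Qed.

Lemma permuteE n (X : n.-tuple (int * U)) (s : 'S_n) : permute X s = perm_seq X s.
Proof. by rewrite /perm_seq /perm_list -[RHS]map_comp. Qed.

Lemma koszulE n (X : n.-tuple (int * U)) (s : 'S_n) :
  koszul X s = (-1) ^+ koszul_parity odd_deg (@ord_lt n) (tnth X) (perm_list s).
Proof.
have H (e : seq 'I_n) : pairwise (@ord_lt n) e ->
  \prod_(a <- e) \prod_(b <- e | (a < b)%N && (s b < s a)%N)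
     (-1) ^ ((tnth X (s a)).1 * (tnth X (s b)).1)
  = (-1) ^+ koszul_parity odd_deg (@ord_lt n) (tnth X) (map s e) :> K.
  elim: e => [|i e IH] /=; first by rewrite big_nil.
  case/andP=> ie /IH{}IH; rewrite big_cons signr_addb -IH; congr (_ * _).
    rewrite big_cons ltnn /= /inversion_parity big_map.
    rewrite (@big_morph _ _ (fun b : bool => (-1) ^+ b : K) 1 *%R false addb) ?expr0 //;
      last exact: signr_addb.
    rewrite big_seq_cond [RHS]big_seq_cond; apply: eq_big => [j|j _].
      by apply: andb_id2l => je; have := allP ie _ je; rewrite /ord_lt => ->.
    exact: expN1_mulz.
  rewrite big_seq [RHS]big_seq; apply: eq_bigr => j je.
  by rewrite big_cons; have /ltnW := allP ie j je; rewrite leqNgt => /negbTE ->.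
rewrite -(H _ (enum_ord_pairwise n)) /koszul big_enum.
by apply: eq_bigr => a _; rewrite big_enum_cond.
Qed.

End LinftyLists.

(** * Twisting L-infinity[1]-algebras *)

Section FiniteSums.

Variable V : zmodType.
Implicit Types (f : nat -> V) (g : nat -> nat -> V).

Lemma sum_bound f N M : (forall n, (N <= n)%N -> f n = 0) -> (N <= M)%N ->
  \sum_(n < M) f n = \sum_(n < N) f n.
Proof.
move=> f0 NM; rewrite (big_ord_widen_cond _ xpredT f NM) [RHS]big_mkcond /=.
by apply: eq_bigr => n _; case: ltnP => // /f0.
Qed.

Lemma fsum_bound f N : (forall n, (N <= n)%N -> f n = 0) ->
  \sum_(n \in [set: nat]) f n = \sum_(n < N) f n.
Proof.
move=> f0; rewrite fsbig_ord; apply/esym/fsbig_widen => // n [_ /= nN].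
by rewrite f0 // leqNgt; apply/negP.
Qed.

Lemma sum_triangle g M :
  \sum_(R < M) \sum_(k < R.+1) g k (R - k)%N = \sum_(k < M) \sum_(m < M - k) g k m.
Proof.
elim: M => [|M IH]; first by rewrite !big_ord0.
rewrite big_ord_recr IH /= [in RHS]big_ord_recr /= subSnn big_ord1.
rewrite [X in _ + X = _]big_ord_recr /= subnn addrA; congr (_ + _).
rewrite -big_split; apply: eq_bigr => k _ /=.
by rewrite subSn ?big_ord_recr // ltnW.
Qed.

(** From [N0 + N1] on, the triangle contains the rectangle outside of which [g] vanishes. *)
Lemma sum_triangle_bound g N0 N1 M :
  (forall k m, (N0 <= k)%N -> g k m = 0) -> (forall k m, (N1 <= m)%N -> g k m = 0) ->
  (N0 + N1 <= M)%N ->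
  \sum_(R < M) \sum_(k < R.+1) g k (R - k)%N = \sum_(k < N0) \sum_(m < N1) g k m.
Proof.
move=> g0 g1 NM; rewrite sum_triangle.
rewrite (@sum_bound (fun k => \sum_(m < M - k) g k m) N0) => [||]; first last.
- exact: leq_trans (leq_addr _ _) NM.
- by move=> k Nk; rewrite big1 // => m _; apply: g0.
apply: eq_bigr => k _; apply: sum_bound; first exact: g1.
apply: leq_trans (leq_sub2l M (ltnW (ltn_ord k))).
by rewrite leq_subRL // (leq_trans (leq_addr _ _) NM).
Qed.

Lemma sum_pascal f N :
  \sum_(k < N.+2) f k *+ 'C(N.+1, k)
  = \sum_(k < N.+1) f k.+1 *+ 'C(N, k) + \sum_(k < N.+1) f k *+ 'C(N, k).
Proof.
rewrite big_ord_recl /= bin0.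
under eq_bigr do rewrite /bump /= add1n binS mulrnDr.
rewrite big_split /= addrCA addrA addrC; congr (_ + _).
rewrite [RHS]big_ord_recl bin0 addrC; congr (_ + _).
by rewrite big_ord_recr /= bin_small // mulr0n addr0.
Qed.

End FiniteSums.

(** Even entries move without sign, so the splittings of the [N] equal copies differ only by how
    many go to the left; the binomial coefficient counts them. *)
Lemma unsh_nseq (K : fieldType) (E : Type) (p : E -> bool) (V : lmodType K)
    (x : E) N (X : seq E) (F : seq E -> seq E -> V) : p x = false ->
  unsh p (nseq N x ++ X) F = \sum_(k < N.+1)
    unsh p X (fun a b => F (nseq k x ++ a) (nseq (N - k) x ++ b)) *+ 'C(N, k).
Proof.
move=> px; elim: N F => [|N IH] F; first by rewrite big_ord1.
rewrite (sum_pascal (fun k =>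
  unsh p X (fun a b => F (nseq k x ++ a) (nseq (N.+1 - k) x ++ b)))) /=.
rewrite !IH; congr (_ + _); apply: eq_bigr => -[k kN] _ /=; congr (_ *+ _).
by apply: eq_unsh => a b; rewrite px scale1r subSn.
Qed.

Definition inv_fact (K : fieldType) (n : nat) : K := (n`!%:R)^-1.

Section ListLinfty.

Variables (K : fieldType) (U : lmodType K).
Hypothesis charK : has_pchar0 K.

Local Notation c := (inv_fact K).

Lemma inv_fact_bin n k : (k <= n)%N -> c n * 'C(n, k)%:R = c k * c (n - k).
Proof.
have nz m : (m`!)%:R != 0 :> K by rewrite ((pcharf0P K).1 charK) -lt0n fact_gt0.
move=> kn; rewrite /inv_fact -(bin_fact kn) !natrM !invfM mulrAC mulVf ?mul1r //.
by have := nz n; rewrite -(bin_fact kn) natrM mulf_eq0 negb_or => /andP[].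
Qed.

Implicit Types (W : int -> {pred U}) (l : seq (int * U) -> U) (X : seq (int * U)).

Definition graded W : pred (int * U) := fun x => x.2 \in W x.1.

(* [Linfty1_algebra] in terms of lists. The operation [l [::]] has to vanish, so
   that the empty [a] contributes nothing to [ll_jacobi]. *)
Record list_Linfty1 W l : Prop := ListLinfty1 {
  ll_subspace : forall d, GRing.submod_closed (W d);
  ll_nil : l [::] = 0;
  ll_degree : forall X, homogeneous W X -> l X \in W (tot_deg X + 1);
  ll_multilinear : forall X Y d (a : K) x y,
    homogeneous W X -> homogeneous W Y -> x \in W d -> y \in W d ->
    l (X ++ (d, a *: x + y) :: Y)
      = a *: l (X ++ (d, x) :: Y) + l (X ++ (d, y) :: Y);
  ll_symmetric : symmetric_on (@odd_deg K U) (graded W) l;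
  ll_jacobi : forall X, homogeneous W X ->
    unsh (@odd_deg K U) X (fun a b => l ((tot_deg a + 1, l a) :: b)) = 0
}.

Section Basics.

Variables (W : int -> {pred U}) (l : seq (int * U) -> U).
Hypothesis Wsub : forall d, GRing.submod_closed (W d).
Hypothesis lmul : forall X Y d (a : K) x y,
    homogeneous W X -> homogeneous W Y -> x \in W d -> y \in W d ->
    l (X ++ (d, a *: x + y) :: Y)
      = a *: l (X ++ (d, x) :: Y) + l (X ++ (d, y) :: Y).

Lemma graded0 d : 0 \in W d. Proof. by have [] := Wsub d. Qed.

Lemma gradedD d (a : K) u v : u \in W d -> v \in W d -> a *: u + v \in W d.
Proof. by have [_] := Wsub d; apply. Qed.

Lemma graded_sum d n (f : nat -> K) (u : nat -> U) :
  (forall i, u i \in W d) -> \sum_(i < n) f i *: u i \in W d.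
Proof.
move=> Wu; elim: n => [|n IH]; first by rewrite big_ord0 graded0.
by rewrite big_ord_recr /= addrC; apply: gradedD.
Qed.

Lemma multilinear0 X Y d : homogeneous W X -> homogeneous W Y ->
  l (X ++ (d, 0) :: Y) = 0.
Proof.
move=> WX WY; have := @lmul X Y d (-1) 0 0 WX WY (graded0 d) (graded0 d).
by rewrite scaler0 addr0 scaleN1r addNr.
Qed.

Lemma multilinear_sum X Y d n (f : nat -> K) (u : nat -> U) :
  homogeneous W X -> homogeneous W Y -> (forall i, u i \in W d) ->
  l (X ++ (d, \sum_(i < n) f i *: u i) :: Y) = \sum_(i < n) f i *: l (X ++ (d, u i) :: Y).
Proof.
move=> WX WY Wu; elim: n => [|n IH]; first by rewrite !big_ord0 multilinear0.
by rewrite !big_ord_recr /= addrC lmul ?IH ?graded_sum // addrC.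
Qed.

End Basics.

Lemma list_Linfty1_algebra W l : list_Linfty1 W l -> Linfty1_algebra W l.
Proof.
case=> Wsub l0 ldeg lmul lsym ljac; split => //.
- by move=> X _; apply: ldeg.
- move=> n X s n0 /all_tnthP WX; rewrite koszulE permuteE.
  rewrite -[in LHS](map_tnth_enum X).
  exact: (symmetric_perm (@ord_lt_irr n) (@ord_lt_trans n) lsym WX (enum_ord_pairwise n)
            (perm_list_perm s)).
move=> n X n0 WX; rewrite -[RHS](ljac X WX).
rewrite big_nat_cond.
under eq_bigr => i /andP[/andP[i0 iN] _].
  under eq_bigr do rewrite koszulE permuteE.
  rewrite (@sum_shuffle _ _ _ _ _ _ i (nest l i)) //.
  over.
rewrite -big_nat_cond big_add1 /= -unsh_sum.
apply: (@eq_unsh_all _ _ _ _ (graded W)); [exact: WX|move=> a b Wa Wb sab].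
case: a Wa sab => [|x a] Wa sab.
  rewrite big1 => [|i _]; last by [].
  by rewrite l0 (multilinear0 Wsub lmul (X := [::])).
have an : (size a < n)%N by rewrite -[n](size_tuple X) -sab addSn ltnS leq_addr.
(* After the shift of the index, [size a] is the only value matching the nonempty first part
   [x :: a]. *)
rewrite (bigD1_seq (size a)) ?mem_index_iota ?iota_uniq //= eqxx big1 ?addr0.
  by rewrite /nest -cat_cons take_size_cat ?drop_size_cat.
by move=> i; rewrite eqSS eq_sym => /negbTE ->.
Qed.

(** There are finitely many splittings, so their thresholds have a maximum. This replaces an
    exchange of limits: the cutoff of the sum defining the twist depends on the arguments. *)
Lemma unsh_eventually (P : pred (int * U)) X F G : all P X ->
  (forall a b, all P a -> all P b ->
     exists N, forall n, (N <= n)%N -> F n a b = G a b :> U) ->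
  exists N, forall n, (N <= n)%N ->
    unsh (@odd_deg K U) X (F n) = unsh (@odd_deg K U) X G.
Proof.
elim: X F G => [|x X IH] F G /=; first by move=> _ FG; apply: FG.
case/andP=> Px PX FG.
have [|N1 N1P] := IH (fun n a b => F n (x :: a) b) (fun a b => G (x :: a) b) PX.
  by move=> a b Pa Pb; apply: FG; rewrite //= Px.
have [|N2 N2P] := IH
                 (fun n a b => (-1) ^+ (odd_deg x && par (@odd_deg K U) a) *: F n a (x :: b))
                 (fun a b => (-1) ^+ (odd_deg x && par (@odd_deg K U) a) *: G a (x :: b)) PX.
  move=> a b Pa Pb; have [||N NP] := FG a (x :: b) => //=; first by rewrite Px.
  by exists N => n /NP ->.
exists (maxn N1 N2) => n; rewrite geq_max => /andP[n1 n2].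
by rewrite N1P // N2P.
Qed.

Lemma homogeneous_cat W X Y :
  homogeneous W (X ++ Y) = homogeneous W X && homogeneous W Y.
Proof. exact: all_cat. Qed.

Lemma tot_deg_cat X Y : tot_deg (X ++ Y) = tot_deg X + tot_deg Y.
Proof. exact: big_cat. Qed.

Section Twist.

Variables (W : int -> {pred U}) (l : seq (int * U) -> U) (alpha : U).
Hypotheses (ll : list_Linfty1 W l) (W_alpha : alpha \in W 0).
Hypothesis nilp : forall X, homogeneous W X ->
  exists N, forall n, (N <= n)%N -> l (nseq n (0, alpha) ++ X) = 0.

Local Notation alphas n := (nseq n (0 : int, alpha)).
Local Notation lT := (twist l alpha).

Lemma homogeneous_nseq n u : u \in W 0 -> homogeneous W (nseq n (0, u)).
Proof. by move=> Wu; elim: n => //= n ->; rewrite Wu. Qed.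

Lemma tot_deg_nseq n (u : U) : tot_deg (nseq n (0 : int, u)) = 0.
Proof. by rewrite /tot_deg big_nseq; elim: n => //= n ->. Qed.

Let Walphas n X : homogeneous W X -> homogeneous W (alphas n ++ X).
Proof. by move=> WX; rewrite homogeneous_cat homogeneous_nseq. Qed.

Lemma twist_sum X N : (forall n, (N <= n)%N -> l (alphas n ++ X) = 0) ->
  lT X = \sum_(n < N) c n *: l (alphas n ++ X).
Proof. by move=> lN; apply: fsum_bound => n /lN ->; rewrite scaler0. Qed.

(* The Jacobi identity of [l] at [alpha, ..., alpha, X], with [R] copies of
   [alpha], is a sum over [k <= R] and over the splittings of [X]; dividing by
   [R!] turns the binomial coefficient into [1 / (k! (R - k)!)], so that summing
   over [R] yields the Jacobi identity of the twist, plus terms containing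
   [lT [::]]. *)
Lemma list_Linfty1_twist : lT [::] = 0 -> list_Linfty1 W lT.
Proof.
have [Wsub l0 ldeg lmul lsym ljac] := ll.
move=> lT0; split => //.
- move=> X WX; have [N /twist_sum ->] := nilp WX.
  apply: (@graded_sum _ Wsub _ _ _ (fun i => l (alphas i ++ X))) => i.
  by have := ldeg _ (Walphas i WX); rewrite tot_deg_cat tot_deg_nseq add0r.
- move=> X Y d a x y WX WY Wx Wy.
  have WXY z : z \in W d -> homogeneous W (X ++ (d, z) :: Y).
    by move=> Wz; rewrite homogeneous_cat WX /= Wz.
  have [N1 N1P] := nilp (WXY x Wx); have [N2 N2P] := nilp (WXY y Wy).
  have lE n : l (alphas n ++ X ++ (d, a *: x + y) :: Y)
     = a *: l (alphas n ++ X ++ (d, x) :: Y) + l (alphas n ++ X ++ (d, y) :: Y).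
    by rewrite !catA lmul ?Walphas.
  pose N := maxn N1 N2.
  rewrite (@twist_sum _ N) => [|n]; last first.
    by rewrite geq_max => /andP[/N1P n1 /N2P n2]; rewrite lE n1 n2 scaler0 addr0.
  rewrite (@twist_sum (X ++ (d, x) :: Y) N) => [|n]; last first.
    by rewrite geq_max => /andP[/N1P ->].
  rewrite (@twist_sum (X ++ (d, y) :: Y) N) => [|n]; last first.
    by rewrite geq_max => /andP[_ /N2P ->].
  rewrite scaler_sumr -big_split; apply: eq_bigr => n _ /=.
  by rewrite lE scalerDr !scalerA [a * _]mulrC.
- move=> X x y Y WX Wx Wy WY.
  have WXY u v : graded W u -> graded W v -> homogeneous W (X ++ u :: v :: Y).
    move=> Wu Wv; rewrite homogeneous_cat; apply/andP; split; first exact: WX.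
    by apply/and3P; split.
  have lE n : l (alphas n ++ X ++ x :: y :: Y)
     = (-1) ^+ (odd_deg x && odd_deg y) *: l (alphas n ++ X ++ y :: x :: Y).
    by rewrite !catA lsym //; apply: Walphas.
  have [N NP] := nilp (WXY y x Wy Wx).
  rewrite (@twist_sum _ N) => [|n /NP nP]; last by rewrite lE nP scaler0.
  rewrite (@twist_sum (X ++ y :: x :: Y) N) // scaler_sumr; apply: eq_bigr => n _.
  by rewrite lE !scalerA mulrC.
move=> X WX.
pose F M a b := \sum_(R < M) \sum_(k < R.+1) (c k * c (R - k)) *:
  l (alphas (R - k) ++ (tot_deg a + 1, l (alphas k ++ a)) :: b).
have F0 M : unsh (@odd_deg K U) X (F M) = 0.
  rewrite unsh_sum big1 // => -[R RM] _ /=.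
  have := ljac _ (Walphas R WX); rewrite unsh_nseq // => /(congr1 (fun u => c R *: u)).
  rewrite scaler0 scaler_sumr unsh_sum => J; rewrite -[RHS]J; apply: eq_bigr => -[k kR] _ /=.
  rewrite -scaler_nat scalerA inv_fact_bin // unshZ; congr (_ *: _).
  apply: (@eq_unsh_all _ _ _ _ (graded W)); [exact: WX|move=> a b Wa Wb _].
  have Wy : graded W (tot_deg a + 1, l (alphas k ++ a)).
    by have := ldeg _ (Walphas k Wa); rewrite tot_deg_cat tot_deg_nseq add0r.
  rewrite tot_deg_cat tot_deg_nseq add0r.
  rewrite (symmetric_move lsym) //; last exact: homogeneous_nseq.
  by rewrite par_tot_deg tot_deg_nseq andbF scale1r.
have [|N NP] := @unsh_eventually (graded W) X F
    (fun a b => lT ((tot_deg a + 1, lT a) :: b)) WX;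
  last exact: etrans (esym (NP N (leqnn N))) (F0 N).
move=> a b Wa Wb.
have [N0 N0P] := nilp Wa.
pose y k := l (alphas k ++ a); set d := tot_deg a + 1.
have Wy k : y k \in W d.
  by have := ldeg _ (Walphas k Wa); rewrite tot_deg_cat tot_deg_nseq add0r.
(* The cutoff for [m] has to be uniform in [k]. Since [y k = 0] from [N0] on, a maximum over
   finitely many [k] suffices. *)
have [N1 N1P] : exists N1, forall k m, (N1 <= m)%N -> l (alphas m ++ (d, y k) :: b) = 0.
  have [N1 N1P] : exists N1, forall k m, (k < N0)%N -> (N1 <= m)%N ->
      l (alphas m ++ (d, y k) :: b) = 0.
    elim: N0 {N0P} => [|N0 [N1 N1P]]; first by exists 0%N.
    have [|N2 N2P] := nilp (X := (d, y N0) :: b); first by rewrite /= Wy.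
    exists (maxn N1 N2) => k m; rewrite ltnS leq_eqVlt geq_max => /orP[/eqP ->|kN] /andP[].
      by move=> _ /N2P.
    by move=> /(N1P _ _ kN).
  exists N1 => k m Nm; case: (ltnP k N0) => [kN|/N0P yk]; first exact: N1P.
  by rewrite /y yk (multilinear0 Wsub lmul) ?homogeneous_nseq.
exists (N0 + N1)%N => M NM.
rewrite /F (@sum_triangle_bound _ (fun k m =>
  (c k * c m) *: l (alphas m ++ (d, y k) :: b)) N0 N1) => [|k m Nk|k m Nm|]; first last.
- exact: NM.
- by rewrite N1P // scaler0.
- by rewrite /y N0P // (multilinear0 Wsub lmul) ?homogeneous_nseq ?scaler0.
have lTE m : l (alphas m ++ (d, lT a) :: b) = \sum_(k < N0) c k *: l (alphas m ++ (d, y k) :: b).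
  by rewrite (twist_sum N0P) (@multilinear_sum _ _ Wsub lmul (alphas m) b d N0 c y) ?homogeneous_nseq.
rewrite (@twist_sum _ N1) => [|m Nm]; last first.
  by rewrite lTE big1 // => k _; rewrite N1P // scaler0.
rewrite exchange_big; apply: eq_bigr => m _; rewrite lTE scaler_sumr.
by apply: eq_bigr => k _; rewrite scalerA mulrC.
Qed.

End Twist.

(** * Maurer-Cartan elements of a twist *)

Section MaurerCartan.

Variables (W : int -> {pred U}).

(** Trades the finitely supported sum over positive [k] for a bounded sum starting at [0], whose
    first term vanishes by [l [::] = 0]. *)
Lemma Maurer_Cartan_sum l alpha N : alpha \in W 0 -> l [::] = 0 ->
  (forall n, (N <= n)%N -> l (nseq n (0, alpha)) = 0) ->
  Maurer_Cartan W l alpha <-> \sum_(n < N) c n *: l (nseq n (0, alpha)) = 0.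
Proof.
move=> Wa l0 lN.
have tN n : (N <= n)%N -> MC_term l alpha n = 0.
  by move=> /lN; rewrite /MC_term => ->; rewrite scaler0.
have fin : finite_set [set k | (0 < k)%N /\ MC_term l alpha k != 0].
  apply: (sub_finite_set (B := `I_N)); last exact: finite_II.
  by move=> k /= [_]; rewrite ltnNge; apply: contra => /tN ->.
have -> : \sum_(n < N) c n *: l (nseq n (0, alpha))
    = \sum_(k \in [set k | (0 < k)%N]) MC_term l alpha k.
  rewrite -(@fsum_bound _ (MC_term l alpha) N tN); apply/esym.
  apply: fsbig_widen => // k [_ /= k0].
  by case: k k0 => [_|k []//]; rewrite /MC_term /= l0 scaler0.
by split=> [[]|].
Qed.

Section Binomial.

Variables (l : seq (int * U) -> U) (alpha beta : U).
Hypotheses (ll : list_Linfty1 W l) (Wa : alpha \in W 0) (Wb : beta \in W 0).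

Local Notation mixed n k := (l (nseq n (0 : int, alpha) ++ nseq k (0, beta))).

Lemma multilinear_binomial R :
  l (nseq R (0, alpha + beta)) = \sum_(k < R.+1) mixed (R - k) k *+ 'C(R, k).
Proof.
have [Wsub l0 ldeg lmul lsym ljac] := ll.
have Wab : alpha + beta \in W 0 by rewrite -[alpha]scale1r; apply: gradedD.
(* The prefix [Y] collects the copies of [alpha] or [beta] already chosen, so that the sums can be
   expanded one argument at a time. *)
suff H (Y : seq (int * U)) : homogeneous W Y -> l (Y ++ nseq R (0, alpha + beta))
    = \sum_(k < R.+1) l (Y ++ nseq (R - k) (0, alpha) ++ nseq k (0, beta)) *+ 'C(R, k).
  exact: (H [::]).
elim: R Y => [|R IH] Y WY; first by rewrite big_ord1.
rewrite (sum_pascal (fun k => l (Y ++ nseq (R.+1 - k) (0, alpha) ++ nseq k (0, beta)))) /=.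
rewrite -{1}[alpha]scale1r lmul ?homogeneous_nseq // scale1r addrC.
rewrite -!cat_rcons !IH ?all_rcons /homogeneous ?all_rcons ?Wa ?Wb //.
congr (_ + _); apply: eq_bigr => -[k kR] _ /=; congr (_ *+ _).
  have Ysym : symmetric_on (@odd_deg K U) (graded W) (fun Z => l (Y ++ Z)).
    by move=> Z x y Z' WZ Wx Wy WZ'; rewrite !catA lsym // all_cat WZ andbT; apply: WY.
  rewrite subSS cat_rcons (symmetric_move Ysym) ?andbF ?scale1r //; exact: homogeneous_nseq.
by rewrite cat_rcons subSn.
Qed.

(** The exponential law: the terms [l (alpha^n, beta^k) / (n! k!)], grouped by [R = n + k], add up
    to [l ((alpha + beta)^R) / R!]. The Maurer-Cartan equation of [alpha] says that the twist
    vanishes on the empty list. *)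
Lemma Maurer_Cartan_twist N : (0 < N)%N ->
  (forall n k, (N <= n + k)%N -> mixed n k = 0) ->
  \sum_(n < N) c n *: l (nseq n (0, alpha)) = 0 ->
  Maurer_Cartan W (twist l alpha) beta
  <-> \sum_(n < N) c n *: l (nseq n (0, alpha + beta)) = 0.
Proof.
move=> N0 mN mca.
have lT k : twist l alpha (nseq k (0, beta)) = \sum_(n < N) c n *: mixed n k.
  by apply: twist_sum => n Nn; apply: mN; apply: leq_trans (leq_addr _ _).
rewrite (@Maurer_Cartan_sum _ _ N) //; first last.
- by move=> k Nk; rewrite lT big1 // => n _; rewrite mN ?scaler0 // (leq_trans Nk) ?leq_addl.
- by rewrite (lT 0%N); under eq_bigr do rewrite cats0.
suff -> : \sum_(k < N) c k *: twist l alpha (nseq k (0, beta))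
  = \sum_(n < N) c n *: l (nseq n (0, alpha + beta)) by [].
under eq_bigr do rewrite lT scaler_sumr.
under eq_bigr do under eq_bigr do rewrite scalerA.
rewrite -(@sum_triangle_bound _ (fun k n => (c k * c n) *: mixed n k) N N (N + N)) //; first last.
- by move=> k m Nm; rewrite mN ?scaler0 // (leq_trans Nm) ?leq_addr.
- by move=> k m Nk; rewrite mN ?scaler0 // (leq_trans Nk) ?leq_addl.
rewrite -(@sum_bound _ (fun n => c n *: l (nseq n (0, alpha + beta))) N (N + N)) ?leq_addr //.
  apply: eq_bigr => R _; rewrite multilinear_binomial scaler_sumr.
  by apply: eq_bigr => -[k kR] _ /=; rewrite -scaler_nat scalerA inv_fact_bin.
move=> R NR; rewrite multilinear_binomial big1 ?scaler0 // => -[k kR] _ /=.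
by rewrite mN ?mul0rn // subnK.
Qed.

End Binomial.

End MaurerCartan.

End ListLinfty.

(** * The Gerstenhaber bracket *)

(** Reflection for the tactic [zmod]: an identity in an abelian group is proved by comparing integer
    coefficients. Once all parities are fixed, the Jacobi identities below are of this kind. *)
Inductive zexp := ZVar of nat | ZZero | ZAdd of zexp & zexp | ZOpp of zexp.

Section ZmodReflection.

Variable V : zmodType.

Fixpoint zeval (env : seq V) (e : zexp) : V :=
  match e with
  | ZVar i => env`_i
  | ZZero => 0
  | ZAdd a b => zeval env a + zeval env b
  | ZOpp a => - zeval env a
  end.

Fixpoint zcoef (e : zexp) (i : nat) : int :=
  match e with
  | ZVar j => if i == j then 1 else 0
  | ZZero => 0
  | ZAdd a b => zcoef a i + zcoef b i
  | ZOpp a => - zcoef a i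
  end.

Lemma zevalE env e : zeval env e = \sum_(i < size env) env`_i *~ zcoef e i.
Proof.
elim: e => [j||a IHa b IHb|a IHa] /=.
- case: (ltnP j (size env)) => [js|js]; last first.
    rewrite nth_default // big1 // => -[i /= ie] _.
    by case: eqP => // ij; move: js; rewrite -ij leqNgt ie.
  rewrite (bigD1 (Ordinal js)) //= eqxx mulr1z big1 ?addr0 // => -[i /= ie] ij.
  by case: eqP => // ij'; case/eqP: ij; apply: val_inj.
- by rewrite big1.
- by rewrite IHa IHb -big_split; apply: eq_bigr => i _; rewrite mulrzDr.
- by rewrite IHa -sumrN; apply: eq_bigr => i _; rewrite mulrNz.
Qed.

Lemma zmod_reflect env e1 e2 :
  all (fun i => zcoef e1 i == zcoef e2 i) (iota 0 (size env)) ->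
  zeval env e1 = zeval env e2.
Proof.
move=> /allP h; rewrite !zevalE; apply: eq_bigr => i _.
by rewrite (eqP (h i _)) // mem_iota /=.
Qed.

End ZmodReflection.

Ltac zmem x env :=
  lazymatch env with
  | nil => false
  | x :: _ => true
  | _ :: ?e => zmem x e
  end.
Ltac zatoms t env :=
  lazymatch t with
  | (?a + ?b)%R => let e := zatoms a env in zatoms b e
  | (- ?a)%R => zatoms a env
  | 0%R => env
  | ?x => lazymatch zmem x env with true => env | false => constr:(x :: env) end
  end.
Ltac zindex x env :=
  lazymatch env with
  | x :: _ => constr:(0%N)
  | _ :: ?e => let i := zindex x e in constr:(S i)
  end.
Ltac zreify t env :=
  lazymatch t with
  | (?a + ?b)%R => let u := zreify a env in let v := zreify b env in constr:(ZAdd u v)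
  | (- ?a)%R => let u := zreify a env in constr:(ZOpp u)
  | 0%R => constr:(ZZero)
  | ?x => let i := zindex x env in constr:(ZVar i)
  end.
Ltac zmod :=
  lazymatch goal with
  | |- @eq ?T ?a ?b =>
    let e := zatoms a (@nil T) in let env := zatoms b e in
    let ea := zreify a env in let eb := zreify b env in
    apply: (@zmod_reflect _ env ea eb); vm_compute; reflexivity
  end.

(** * Insertion of multilinear maps and the pre-Lie identity *)

Section Insertion.

Variables (K : fieldType) (V : lmodType K).

Implicit Types (F G : seq V -> V) (g h : seq V -> V) (s : seq V).

Definition multilinear F : Prop := forall s1 s2, linear (fun v => F (s1 ++ v :: s2)).

(* [circ n g f] is the pre-Lie product of [f] and [g], for [g] of degree [n]; the
   recursion on the arguments makes no reference to the degree of [f]. *)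
Fixpoint circ n g F s : V :=
  if s is v :: s' then
    F (g (v :: take n s') :: drop n s') + (-1) ^+ n *: circ n g (fun t => F (v :: t)) s'
  else 0.

Lemma multilinear_cons F v : multilinear F -> multilinear (fun t => F (v :: t)).
Proof. by move=> Fm s1 s2; apply: (Fm (v :: s1)). Qed.

Lemma multilinear_zero F s1 s2 : multilinear F -> F (s1 ++ 0 :: s2) = 0.
Proof. by move=> Fm; have := Fm s1 s2 (-1) 0 0; rewrite scaler0 addr0 scaleN1r addNr. Qed.

Lemma multilinear_mem0 F s : multilinear F -> 0 \in s -> F s = 0.
Proof. by move=> Fm; case/splitPr: s / => s1 s2; apply: multilinear_zero. Qed.

Lemma multilinear_lin (c : K) F G : multilinear F -> multilinear G ->
  multilinear (fun s => c *: F s + G s).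
Proof.
move=> Fm Gm s1 s2 a u v; rewrite Fm Gm !scalerDr !scalerA [c * a]mulrC -!scalerA.
by rewrite addrACA.
Qed.

Lemma circ_ext n g F G : F =1 G -> circ n g F =1 circ n g G.
Proof. by move=> FG s; congr (circ n g _ s); apply/funext. Qed.

Lemma circ_linl (c : K) n g F G s :
  circ n g (fun s => c *: F s + G s) s = c *: circ n g F s + circ n g G s.
Proof.
elim: s F G => [|v s IH] F G /=; first by rewrite scaler0 addr0.
by rewrite IH !scalerDr !scalerA [c * _]mulrC addrACA.
Qed.

Lemma circ_linr (c : K) n g h F s : multilinear F ->
  circ n (fun s => c *: g s + h s) F s = c *: circ n g F s + circ n h F s.
Proof.
elim: s F => [|v s IH] F Fm /=; first by rewrite scaler0 addr0.
rewrite IH ?(Fm [::]); last exact: multilinear_cons.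
by rewrite !scalerDr !scalerA [c * _]mulrC addrACA.
Qed.

Lemma circ_multilinear n g F : multilinear F -> multilinear g ->
  multilinear (circ n g F).
Proof.
move=> Fm gm s1 s2; elim: s1 F Fm => [|w s1 IH] F Fm a u v /=.
  rewrite (gm [::]) (Fm [::]) scalerDr addrACA; congr (_ + _).
  rewrite scalerA [a * _]mulrC -scalerA -scalerDr; congr (_ *: _).
  rewrite -circ_linl; apply: circ_ext => t; exact: (Fm [::]).
rewrite (IH _ (multilinear_cons w Fm)) !scalerDr !scalerA [a * _]mulrC addrACA; congr (_ + _).
rewrite !take_cat !drop_cat; case: ltnP => ns; first by rewrite -!cat_cons Fm.
case e : (n - size s1)%N => [|k] /=; first by rewrite (Fm [:: _]).
by rewrite -!cat_cons gm (Fm [::]).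
Qed.

(** An insertion of [h] falls either into the block fed to [G], which then consumes [n + p] letters,
    or behind that block; in the second case [h] of degree [p] passes [n] letters, whence the
    sign. *)
Lemma circ_split n p G h (F : seq V -> V) s :
  multilinear F -> (forall t, size t != n -> G t = 0) ->
  circ p h (fun u => F (G (take n u) :: drop n u)) s
  = F (circ p h G (take (n + p) s) :: drop (n + p) s)
    + (-1) ^+ (n * p) *: circ p h (fun t => F (G (take n s) :: t)) (drop n s).
Proof.
move=> Fm.
have F0 t : F (0 :: t) = 0 by apply: (multilinear_zero [::]).
elim: n G s => [|n IH] G s Gn.
  have G0 t : G t = if t is [::] then G [::] else 0 by case: t => // v t; rewrite Gn.
  rewrite drop0 mul0n scale1r -[LHS]add0r; congr (_ + _); last first.
    by apply: circ_ext => u; rewrite !take0 drop0.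
  have z t : circ p h G t = 0.
    case: t => //= v t; rewrite Gn // add0r; set H := fun _ => _.
    have -> : H = fun _ => 0 by apply/funext => u; rewrite /H Gn.
    have := circ_linl (-1) p h (fun _ => 0) (fun _ => 0) t.
    rewrite (_ : (fun _ => _) = (fun _ => 0)); last by apply/funext => u; rewrite scaler0 addr0.
    by move=> ->; rewrite scaleN1r addNr scaler0.
  by rewrite z F0.
case: s => [|v s] /=; first by rewrite F0 scaler0 addr0.
rewrite (IH (fun t => G (v :: t))); last by move=> t tn; apply: Gn.
have -> : take p (take (n + p) s) = take p s by rewrite take_takel // leq_addl.
have -> : drop p (take (n + p) s) = take n (drop p s) by rewrite take_drop addnC.
rewrite drop_drop [G _ + _]addrC (Fm [::]) [_ + F (G _ :: _)]addrC -addrA; congr (_ + _).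
by rewrite scalerDr scalerA -exprD mulSn.
Qed.

Definition arity n (g : seq V -> V) := forall t, size t != n -> g t = 0.

(* The associator of the pre-Lie product: the insertions of [g] and [h] into [F]
   at disjoint places. *)
Definition defect n g p h F : seq V -> V := fun s =>
  circ p h (circ n g F) s - circ (n + p) (circ p h g) F s.

(** Disjoint insertions of [g] and [h] are the same configurations whichever is inserted first; the
    sign is that of exchanging maps of degrees [n] and [p]. *)
Lemma circ_prelie n g p h F s : multilinear F -> multilinear g -> multilinear h ->
  arity n.+1 g -> arity p.+1 h ->
  defect n g p h F s = (-1) ^+ (n * p) *: defect p h n g F s.
Proof.
move=> + gm hm ga ha; rewrite /defect; elim: s F => [|v s IH] F Fm /=.
  by rewrite subrr scaler0.
(* [g], [h] both behind [v], or one of them at [v] and the other one behind *)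
have half q (k : seq V -> V) r (k' : seq V -> V) : multilinear k -> arity q.+1 k ->
  circ r k' (circ q k F) (v :: s) - circ (q + r) (circ r k' k) F (v :: s)
  = (-1) ^+ q *: circ q k (fun t => F (k' (v :: take r s) :: t)) (drop r s)
  + (-1) ^+ (r + q * r) *: circ r k' (fun t => F (k (v :: take q s) :: t)) (drop q s)
  + (-1) ^+ (q + r) *: (circ r k' (circ q k (fun t => F (v :: t))) s
      - circ (q + r) (circ r k' k) (fun t => F (v :: t)) s).
  move=> km ka /=.
  have e1 : take r (take (q + r) s) = take r s by rewrite take_takel // leq_addl.
  have e2 : drop r (take (q + r) s) = take q (drop r s) by rewrite take_drop addnC.
  rewrite e1 e2 drop_drop.
  have -> : circ r k' (fun t => F (k (v :: take q t) :: drop q t)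
               + (-1) ^+ q *: circ q k (fun t' => F (v :: t')) t) s
      = F (circ r k' (fun t => k (v :: t)) (take (q + r) s) :: drop (q + r) s)
        + (-1) ^+ (q * r) *: circ r k' (fun t => F (k (v :: take q s) :: t)) (drop q s)
        + (-1) ^+ q *: circ r k' (circ q k (fun t => F (v :: t))) s.
    rewrite addrC -circ_split //; last by move=> t tq; apply: ka.
    by rewrite -circ_linl; apply: circ_ext => t; rewrite addrC.
  rewrite [k _ + _]addrC (Fm [::]) /= !scalerDr !scalerA -!exprD [(r + q)%N]addnC scalerN.
  set a1 := F _; set a2 := _ *: _; set a3 := _ *: F _; set a4 := _ *: _; set a5 := _ *: _.
  set a6 := _ *: circ (q + r) _ _ _. generalize a1 a2 a3 a4 a5 a6 => *; zmod.
rewrite (half n g p h) // (half p h n g) // IH; last exact: multilinear_cons.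
rewrite [RHS]scalerDr scalerDr !scalerA -!exprD [(p + n)%N]addnC [(p * n)%N]mulnC.
rewrite [X in X + _ = _]addrC; congr (_ + _); last first.
  by rewrite -scalerDr scalerA -exprD addnC.
rewrite scalerDr !scalerA -!exprD; congr (_ + _); congr (_ *: _).
  by rewrite addnC.
by rewrite addnCA -[RHS]signr_odd !oddD addbb addbF signr_odd.
Qed.

Lemma signr_nat n : (-1) ^+ n = (-1) ^+ (odd n) :> K.
Proof. by rewrite signr_odd. Qed.

End Insertion.

Section GerstenhaberBracket.

Variables (K : fieldType) (V : lmodType K).
Implicit Types (f g h : seq V -> V).

Lemma is_hom_multilinear n f : is_hom n f -> multilinear f.
Proof. by case. Qed.

Lemma is_hom_arity n f : is_hom n f -> arity n.+1 f.
Proof. by case. Qed.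

Lemma is_hom0 n : is_hom n (0 : seq V -> V).
Proof. by split=> // s1 s2 a u v; rewrite scaler0 addr0. Qed.

Lemma is_hom_lin n (c : K) f g : is_hom n f -> is_hom n g -> is_hom n (c *: f + g).
Proof.
move=> [fm fa] [gm ga]; split; first exact: (multilinear_lin c fm gm).
by move=> s sn; rewrite /GRing.add /GRing.scale /= fa // ga // scaler0 addr0.
Qed.

Lemma circ_sum n g f s : multilinear f -> arity n.+1 g ->
  circ n g f s = \sum_(i < size s) (-1) ^+ (i * n) *:
     f (take i s ++ g (take n.+1 (drop i s)) :: drop (i + n.+1) s).
Proof.
elim: s f => [|v s IH] f fm ga /=; first by rewrite big_ord0.
rewrite big_ord_recl /= scale1r; congr (_ + _).
rewrite (IH _ (multilinear_cons v fm)) // scaler_sumr; apply: eq_bigr => i _.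
by rewrite scalerA -exprD /bump /= add1n mulSn.
Qed.

(** The two sums have different ranges, [m + 1] and [size s]. A position beyond [m] gives [f] too
    many arguments, one beyond the end of [s] gives [g] none, so the extra terms vanish. *)
Lemma gdotE m n f g : is_hom m f -> is_hom n g -> gdot m n f g = circ n g f.
Proof.
move=> [fm fa] [gm ga]; apply/funext => s; rewrite circ_sum // /gdot.
pose G i := (-1) ^+ (i * n) *: f (take i s ++ g (take n.+1 (drop i s)) :: drop (i + n.+1) s).
have G0 i : (m < i)%N || (size s <= i)%N -> G i = 0.
  rewrite /G => mi; have [si|si] := leqP (size s) i.
    by rewrite [drop i s]drop_oversize // ga // multilinear_zero // scaler0.
  move: mi; rewrite [(size s <= i)%N]leqNgt si orbF => mi; rewrite fa ?scaler0 //.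
  rewrite size_cat size_take si /= addnS eqSS; apply: contraTneq mi => <-.
  by rewrite -leqNgt leq_addr.
rewrite -(@sum_bound _ G m.+1 (m.+1 + size s)); [|by move=> i mi; rewrite G0 ?mi|exact: leq_addr].
by apply: sum_bound => [i si|]; rewrite ?leq_addl // G0 // si orbT.
Qed.

Lemma is_hom_circ m n f g : is_hom m f -> is_hom n g -> is_hom (m + n) (circ n g f).
Proof.
move=> [fm fa] [gm ga]; split; first exact: circ_multilinear.
move=> s sn; rewrite circ_sum // big1 // => -[i /= si] _.
have [ns|ns] := leqP n.+1 (size (drop i s)); last first.
  by rewrite ga ?multilinear_zero ?scaler0 // size_take ltnNge (ltnW ns) /= neq_ltn ns.
rewrite fa ?scaler0 //; apply: contra sn.
rewrite size_cat size_take si /= size_drop; move: ns; rewrite size_drop => ns.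
have le : (i + n.+1 <= size s)%N by rewrite -leq_subRL // ltnW.
by rewrite addnS eqSS => /eqP <-; rewrite -addnS addnAC subnKC.
Qed.

Lemma is_hom_bracket m n f g : is_hom m f -> is_hom n g ->
  is_hom (m + n) (gbracket (m, f) (n, g)).2.
Proof.
move=> fh gh; rewrite /gbracket /= !gdotE // addrC -scaleNr.
by apply: is_hom_lin; [rewrite addnC|]; apply: is_hom_circ.
Qed.

Lemma gbracketC m n f g :
  (gbracket (m, f) (n, g)).2 = - (-1) ^+ (m * n) *: (gbracket (n, g) (m, f)).2.
Proof.
rewrite /gbracket /= [(n * m)%N]mulnC scaleNr scalerBr scalerA -expr2 sqrr_sign scale1r.
by rewrite opprB addrC.
Qed.

Lemma circBl (c : K) n g f h : circ n g (f - c *: h) = circ n g f - c *: circ n g h.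
Proof.
apply/funext => s; rewrite [f - _]addrC -scaleNr.
rewrite (_ : - c *: h + f = fun s => - c *: h s + f s) // circ_linl addrC scaleNr.
by [].
Qed.

Lemma circBr (c : K) n g h f : multilinear f ->
  circ n (g - c *: h) f = circ n g f - c *: circ n h f.
Proof.
move=> fm; apply/funext => s; rewrite [g - _]addrC -scaleNr.
rewrite (_ : - c *: h + g = fun s => - c *: h s + g s) // circ_linr // addrC scaleNr.
by [].
Qed.

Lemma gdot_linl (c : K) m n f f' g :
  gdot m n (c *: f + f') g = c *: gdot m n f g + gdot m n f' g.
Proof.
apply/funext => s; rewrite -[RHS]/(c *: gdot m n f g s + gdot m n f' g s).
rewrite /gdot scaler_sumr -big_split; apply: eq_bigr => i _ /=.
rewrite -[(_ + _) (_ ++ _)]/(c *: f _ + f' _).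
by rewrite scalerDr !scalerA mulrC.
Qed.

Lemma gdot_linr (c : K) m n f g g' : multilinear f ->
  gdot m n f (c *: g + g') = c *: gdot m n f g + gdot m n f g'.
Proof.
move=> fm; apply/funext => s; rewrite -[RHS]/(c *: gdot m n f g s + gdot m n f g' s).
rewrite /gdot scaler_sumr -big_split; apply: eq_bigr => i _ /=.
rewrite -[(_ + _) (take _ _)]/(c *: g _ + g' _).
by rewrite fm scalerDr !scalerA mulrC.
Qed.

Lemma gbracket_linl (c : K) m n f f' g : multilinear g ->
  (gbracket (m, c *: f + f') (n, g)).2
  = c *: (gbracket (m, f) (n, g)).2 + (gbracket (m, f') (n, g)).2.
Proof.
move=> gm; rewrite /gbracket /= gdot_linl gdot_linr //.
by rewrite scalerBr scalerDr opprD addrACA !scalerA [c * _]mulrC.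
Qed.

Lemma gbracket_linr (c : K) m n f g g' : multilinear f ->
  (gbracket (m, f) (n, c *: g + g')).2
  = c *: (gbracket (m, f) (n, g)).2 + (gbracket (m, f) (n, g')).2.
Proof.
move=> fm; rewrite !(gbracketC m) gbracket_linl //.
by rewrite scalerDr !scalerA mulrC.
Qed.

Lemma gbracket_0l m n g : multilinear g -> (gbracket (m, 0) (n, g)).2 = 0.
Proof.
move=> gm; have := gbracket_linl (-1) m n 0 0 gm.
by rewrite scaler0 addr0 scaleN1r addNr.
Qed.

Lemma gbracket_0r m n f : multilinear f -> (gbracket (m, f) (n, 0)).2 = 0.
Proof. by move=> fm; rewrite gbracketC gbracket_0l // scaler0. Qed.

Lemma gbracket_Zl (c : K) m n f g : multilinear g ->
  (gbracket (m, c *: f) (n, g)).2 = c *: (gbracket (m, f) (n, g)).2.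
Proof.
move=> gm; have := gbracket_linl c m n f 0 gm.
by rewrite gbracket_0l // !addr0.
Qed.

Lemma gbracket_Zr (c : K) m n f g : multilinear f ->
  (gbracket (m, f) (n, c *: g)).2 = c *: (gbracket (m, f) (n, g)).2.
Proof.
move=> fm; have := gbracket_linr c m n g 0 fm.
by rewrite gbracket_0r // !addr0.
Qed.

Lemma circ_defect n p f g h : is_hom n g -> is_hom p h -> multilinear f ->
  circ p h (circ n g f) = circ (n + p) (circ p h g) f + defect n g p h f /\
  circ n g (circ p h f)
    = circ (n + p) (circ n g h) f + (-1) ^+ (n * p) *: defect n g p h f.
Proof.
move=> [gm ga] [hm ha] fm.
have dE q k r k' : circ r k' (circ q k f) = circ (q + r) (circ r k' k) f + defect q k r k' f.
  by apply/funext => s; rewrite !addrfctE /defect addrC subrK.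
split; first exact: dE.
rewrite dE [(p + n)%N]addnC; congr (_ + _).
apply/funext => s; rewrite (circ_prelie s fm hm gm ha ga).
by rewrite mulnC.
Qed.

Lemma gbracket_jacobi m n p f g h : is_hom m f -> is_hom n g -> is_hom p h ->
  (gbracket (gbracket (m, f) (n, g)) (p, h)).2
  = (gbracket (m, f) (gbracket (n, g) (p, h))).2
    + (-1) ^+ (n * p) *: (gbracket (gbracket (m, f) (p, h)) (n, g)).2.
Proof.
move=> fh gh hh.
have := is_hom_bracket fh gh; have := is_hom_bracket gh hh; have := is_hom_bracket fh hh.
have /is_hom_multilinear fm := fh; have /is_hom_multilinear gm := gh.
have /is_hom_multilinear hm := hh.
rewrite /gbracket /= => b1 b2 b3; rewrite !gdotE // in b1 b2 b3; rewrite !gdotE //.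
rewrite !circBl !circBr //.
have [-> ->] := circ_defect gh hh fm; have [-> ->] := circ_defect fh hh gm.
have [-> ->] := circ_defect fh gh hm.
(* By the pre-Lie identity, three associators and six nested compositions are the only terms left.
   They can be treated as independent unknowns, with coefficients depending on the three
   parities. *)
set A1 := defect _ _ _ _ _; set A2 := defect _ _ _ _ _; set A3 := defect _ _ _ _ _.
set B1 := circ (n + p) (circ p h g) f; set B2 := circ (n + p) (circ n g h) f.
set B3 := circ (m + p) (circ p h f) g; set B4 := circ (m + p) (circ m f h) g.
set B5 := circ (m + n) (circ n g f) h; set B6 := circ (m + n) (circ m f g) h.
move: B1 B2 B3 B4 B5 B6 A1 A2 A3 => B1 B2 B3 B4 B5 B6 A1 A2 A3.
rewrite ![(-1) ^+ (_ * _)]signr_nat !oddM !oddD.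
case: (odd m); case: (odd n); case: (odd p); rewrite /= ?expr0 ?expr1 ?scale1r ?scaleN1r.
all: zmod.
Qed.

End GerstenhaberBracket.

(** * Projections and weights *)

Section Projections.

Variables (K : fieldType) (A M : lmodType K).

Local Notation V := (A * M)%type.
Implicit Types (f g : seq V -> V) (u v : V) (s : seq V).

Lemma inA_linear : linear (@inA K A M).
Proof. by move=> a u v; apply: injective_projections; rewrite //= scaler0 addr0. Qed.

Lemma inM_linear : linear (@inM K A M).
Proof. by move=> a u v; apply: injective_projections; rewrite //= scaler0 addr0. Qed.

Lemma inAD u v : inA (u + v) = inA u + inA v.
Proof. by have := inA_linear 1 u v; rewrite !scale1r. Qed.

Lemma inAZ (c : K) u : inA (c *: u) = c *: inA u.
Proof. by apply: injective_projections; rewrite //= scaler0. Qed.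

Lemma inM_inA v : inM (inA v) = 0. Proof. by []. Qed.
Lemma inA_inM v : inA (inM v) = 0. Proof. by []. Qed.

Lemma inA_inM_sum v : inA v + inM v = v.
Proof. by apply: injective_projections; rewrite /= ?addr0 ?add0r. Qed.

Lemma multilinear_head f v s : multilinear f ->
  f (v :: s) = f (inA v :: s) + f (inM v :: s).
Proof.
move=> fm; rewrite -{1}(inA_inM_sum v) -{1}[inA v]scale1r.
by have := fm [::] s 1 (inA v) (inM v); rewrite /= scale1r => ->; rewrite scale1r.
Qed.

Lemma map_inM_idem s : map (@inM K A M) (map (@inM K A M) s) = map (@inM K A M) s.
Proof. by rewrite -map_comp. Qed.

Lemma is_hom_projP n f : is_hom n f -> is_hom n (projP f).
Proof.
move=> [fm fa]; split=> [s1 s2 a u v|s sn]; last by rewrite /projP fa ?size_map.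
by rewrite /projP !map_cat /= inM_linear fm inA_linear.
Qed.

Lemma projP_idem f : projP (projP f) = projP f.
Proof. by apply/funext => s; rewrite /projP map_inM_idem. Qed.

Lemma projP_linear : linear (@projP K A M).
Proof. by move=> a f g; apply/funext => s; apply: inA_linear. Qed.

Lemma projPD f g : projP (f + g) = projP f + projP g.
Proof. by have := projP_linear 1 f g; rewrite !scale1r. Qed.

Lemma projPZ (c : K) f : projP (c *: f) = c *: projP f.
Proof. by apply/funext => s; apply: inAZ. Qed.

Lemma projP0 : projP (0 : seq V -> V) = 0.
Proof. by []. Qed.

(** With all arguments in [M], split the value of [g] into its two parts. The part in [A] is the
    value of [projP g]; with the part in [M], all arguments of [f] lie in [M], so that [f] may be
    replaced by [projP f]. *)
Lemma projP_circ n g f : multilinear f ->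
  projP (circ n g f) = projP (circ n (projP g) f) + projP (circ n g (projP f)).
Proof.
move=> fm; apply/funext => s; rewrite addrfctE /projP -/(projP g) -/(projP f).
elim: s f fm => [|v s IH] f fm /=; first by rewrite addr0.
rewrite !inAD !inAZ (IH _ (multilinear_cons (inM v) fm)) scalerDr addrACA.
congr (_ + _).
rewrite -!map_take -!map_drop multilinear_head // inAD.
congr (inA (f _) + _).
  by rewrite /projP /= map_inM_idem.
by rewrite /projP /= map_inM_idem.
Qed.

Lemma projP_bracket m n f g : is_hom m f -> is_hom n g ->
  projP (gbracket (m, f) (n, g)).2
  = projP (gbracket (m, f) (n, projP g)).2 + projP (gbracket (m, projP f) (n, g)).2.
Proof.
move=> fh gh; rewrite /gbracket /= !gdotE //; try exact: is_hom_projP.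
have /is_hom_multilinear fm := fh; have /is_hom_multilinear gm := gh.
have sub (h k : seq V -> V) (c : K) : projP (h - c *: k) = projP h - c *: projP k.
  by rewrite -scaleNr projPD projPZ scaleNr.
rewrite !sub (projP_circ _ _ fm) (projP_circ _ _ gm) scalerDr.
by rewrite opprD [- (_ *: projP (circ m (projP f) g)) - _]addrC addrACA.
Qed.

Lemma projP_inA f s1 v s2 : multilinear f -> projP f (s1 ++ inA v :: s2) = 0.
Proof. by move=> fm; rewrite /projP map_cat /= inM_inA multilinear_zero. Qed.

(** Elements of [a] take values in [A] but vanish as soon as one argument lies in [A]. *)
Lemma in_a_abelian m n f g : in_a m f -> in_a n g -> (gbracket (m, f) (n, g)).2 = 0.
Proof.
suff H k p (h q : seq V -> V) : in_a k h -> in_a p q -> circ p q h = 0.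
  move=> fa ga; rewrite /gbracket /= !gdotE; try by case: fa ga => ? ? [].
  by rewrite (H m n) // (H n m) // scaler0 subrr.
move=> [hh hP] [qh qP]; apply/funext => s; rewrite circ_sum.
- rewrite big1 // => i _; rewrite -qP -hP projP_inA ?scaler0 //.
  exact: is_hom_multilinear hh.
- exact: is_hom_multilinear hh.
exact: is_hom_arity qh.
Qed.

(** A linear endomorphism as a cochain of degree 0. Bracketing with it applies [e] to each input in
    turn and subtracts [e] of the output; for a projection this measures a weight. *)
Definition unary (e : V -> V) : seq V -> V := fun s => if s is [:: v] then e v else 0.

Lemma is_hom_unary e : linear e -> is_hom 0 (unary e).
Proof.
move=> el; split=> [[|w [|w' s1]] [|w2 s2] a u v|[|v [|w s]]] //=;
  by rewrite ?scaler0 ?addr0 // el.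
Qed.

Lemma circ_null n g f s : (forall v t, f (v :: t) = 0) -> circ n g f s = 0.
Proof.
elim: s f => //= v s IH f f0; rewrite f0 add0r IH ?scaler0 //.
Qed.

Lemma circ_unary n f e : is_hom n f -> e 0 = 0 -> circ n f (unary e) = fun s => e (f s).
Proof.
move=> [fm fa] e0; apply/funext => -[|v s] /=; first by rewrite fa.
rewrite circ_null ?scaler0 ?addr0; last by [].
have [ns|sn] := leqP (size s) n; first by rewrite take_oversize // drop_oversize.
rewrite [f (v :: s)]fa /= ?eqSS ?neq_ltn ?sn ?orbT // e0.
by case: (drop n s) (size_drop n s) => //= /eqP; rewrite eq_sym subn_eq0 leqNgt sn.
Qed.

Lemma bracket_unary n f e : linear e -> is_hom n f ->
  (gbracket (n, f) (0, unary e)).2 = circ 0 (unary e) f - (fun s => e (f s)).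
Proof.
move=> el fh; have eh := is_hom_unary el.
have e0 : e 0 = 0 by have := el (-1) 0 0; rewrite scaler0 addr0 scaleN1r addNr.
by rewrite /gbracket /= !gdotE // muln0 expr0 scale1r (circ_unary fh).
Qed.

Definition pure (x : bool * V) : V := if x.1 then inM x.2 else inA x.2.

Definition pures (w : seq (bool * V)) : seq V := map pure w.

Definition Mdegree (w : seq (bool * V)) : nat := count fst w.

Lemma multilinear_pures f g : multilinear f -> multilinear g ->
  (forall w, f (pures w) = g (pures w)) -> f = g.
Proof.
move=> fm gm fg; apply/funext => s; elim: s f g fm gm fg => [|v s IH] f g fm gm fg.
  exact: (fg [::]).
rewrite multilinear_head // [RHS]multilinear_head //; congr (_ + _).
  apply: (IH (fun t => f (inA v :: t)) (fun t => g (inA v :: t))) => [||w].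
  - exact: multilinear_cons.
  - exact: multilinear_cons.
  exact: (fg ((false, v) :: w)).
apply: (IH (fun t => f (inM v :: t)) (fun t => g (inM v :: t))) => [||w].
- exact: multilinear_cons.
- exact: multilinear_cons.
exact: (fg ((true, v) :: w)).
Qed.

Lemma circ_inM_pures f w : multilinear f ->
  circ 0 (unary (@inM K A M)) f (pures w) = f (pures w) *+ Mdegree w.
Proof.
elim: w f => [|[b v] w IH] f fm //=.
rewrite take0 drop0 scale1r (IH _ (multilinear_cons _ fm)) /pure /=.
case: b => /=; first by rewrite -[inM (inM v)]/(inM v) mulrS.
by rewrite inM_inA (multilinear_zero [::]) // add0r.
Qed.

(** Membership in [L'] tested on words with entries in [A] or [M]; the link with [projA] and
    [projAM] is [balanced_proj]. *)
Definition balanced f := forall w,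
  (Mdegree w != 0 -> (f (pures w)).1 = 0) /\ (Mdegree w != 1 -> (f (pures w)).2 = 0).

Hypothesis charK : has_pchar0 K.

Lemma eqr_nat_char0 m n : (m%:R == n%:R :> K) = (m == n).
Proof.
have lt i j : (i < j)%N -> (i%:R == j%:R :> K) = false.
  move=> ij; rewrite eq_sym -subr_eq0 -natrB ?(ltnW ij) // ((pcharf0P K).1 charK).
  by rewrite subn_eq0 leqNgt ij.
by case: ltngtP => [/lt //|/lt|->]; rewrite 1?eq_sym ?eqxx.
Qed.

Lemma mulrn_char0 (U : lmodType K) (u : U) n : n != 0%N -> u *+ n = 0 -> u = 0.
Proof.
move=> n0 /eqP; rewrite -scaler_nat scaler_eq0 ((pcharf0P K).1 charK) (negbTE n0).
by move/eqP.
Qed.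

(* The bracket with the projection to [M] counts the inputs in [M] minus the
   outputs in [M]: it vanishes exactly on [L']. *)
Lemma balanced_bracket n f : is_hom n f ->
  balanced f <-> (gbracket (n, f) (0, unary (@inM K A M))).2 = 0.
Proof.
move=> fh; have /is_hom_multilinear fm := fh.
have fst_mul (u : V) k : (u *+ k).1 = u.1 *+ k by elim: k => // k IH; rewrite !mulrS -IH.
have snd_mul (u : V) k : (u *+ k).2 = u.2 *+ k by elim: k => // k IH; rewrite !mulrS -IH.
rewrite (bracket_unary inM_linear fh); split=> [fb|/eqP].
  apply/eqP; rewrite subr_eq0; apply/eqP; apply: multilinear_pures.
  - by apply: circ_multilinear => //; apply: is_hom_multilinear (is_hom_unary inM_linear).
  - by move=> s1 s2 a u v; rewrite fm inM_linear.
  move=> w; rewrite circ_inM_pures //; have [f1 f2] := fb w.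
  rewrite /inM; apply: injective_projections; rewrite ?fst_mul ?snd_mul /=.
    by have [->|/f1 ->] := eqVneq (Mdegree w) 0%N; rewrite ?mulr0n ?mul0rn.
  by have [->|/f2 ->] := eqVneq (Mdegree w) 1%N; rewrite ?mulr1n ?mul0rn.
rewrite subr_eq0 => /eqP fE w; have := congr1 (fun h => h (pures w)) fE.
rewrite circ_inM_pures // => fw; split=> Mw.
  have := congr1 fst fw; rewrite fst_mul /= => /mulrn_char0; exact.
have := congr1 snd fw; rewrite snd_mul /=; case: (Mdegree w) Mw => [_ <- //|k] k1.
rewrite mulrS => /eqP; rewrite eq_sym addrC -subr_eq subrr eq_sym => /eqP /mulrn_char0; apply.
by case: k k1.
Qed.

Lemma pures_mem0 w : has (fun x => x.1) w -> 0 \in map (@inA K A M) (pures w).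
Proof.
elim: w => //= -[b v] w IH; rewrite inE /pure; case: b => /= [_|/IH ->]; last by rewrite orbT.
by rewrite inA_inM eqxx.
Qed.

Lemma balanced_decompose f : multilinear f ->
  (forall w, (1 < Mdegree w)%N -> f (pures w) = 0) ->
  forall s, f s = f (map (@inA K A M) s)
    + \sum_(p < size s) f (map (@inA K A M) (take p s)
                           ++ inM s`_p :: map (@inA K A M) (drop p.+1 s)).
Proof.
(* The case in which the single entry in [M] has already been used: all remaining arguments can be
   projected to [A]. *)
have one g : multilinear g -> (forall w, (0 < Mdegree w)%N -> g (pures w) = 0) ->
    forall s, g s = g (map (@inA K A M) s).
  move=> gm g0 s; elim: s g gm g0 => //= v s IH g gm g0.
  rewrite multilinear_head // (IH (fun t => g (inA v :: t))).
  - rewrite -[RHS]addr0; congr (_ + _).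
    have E : (fun t => g (inM v :: t)) = fun=> 0.
      apply: multilinear_pures => [||w]; first exact: multilinear_cons.
        by move=> s1 s2 a u u'; rewrite scaler0 addr0.
      exact: (g0 ((true, v) :: w)).
    exact: (congr1 (fun h => h s) E).
  - exact: multilinear_cons.
  by move=> w w0; apply: (g0 ((false, v) :: w)).
move=> fm f0 s; elim: s f fm f0 => [|v s IH] f fm f0 /=; first by rewrite big_ord0 addr0.
rewrite multilinear_head // (IH (fun t => f (inA v :: t))); first last.
- by move=> w w0; apply: (f0 ((false, v) :: w)).
- exact: multilinear_cons.
rewrite big_ord_recl /= drop0 -addrA; congr (_ + _); rewrite addrC; congr (_ + _).
apply: (one (fun t => f (inM v :: t))); first exact: multilinear_cons.
by move=> w w0; apply: (f0 ((true, v) :: w)).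
Qed.

Lemma balanced_proj n f : is_hom n f -> balanced f <-> projA f + projAM f = f.
Proof.
move=> [fm fa]; split=> [fb|fE w].
  apply/funext => s; rewrite addrfctE [RHS]balanced_decompose //; last first.
    move=> w w1; have [f1 f2] := fb w.
    by apply: injective_projections; rewrite ?f1 ?f2 //; case: (Mdegree w) w1 => [|[]].
  have pA (t : seq V) : map (@inA K A M) t = pures [seq (false, v) | v <- t].
    by rewrite /pures -map_comp.
  have cA (t : seq V) : Mdegree [seq (false, v) | v <- t] = 0%N.
    by rewrite /Mdegree count_map; elim: t.
  congr (_ + _).
    rewrite /projA -[RHS]inA_inM_sum -[LHS]addr0; congr (_ + _).
    by rewrite pA /inM (fb _).2 // cA.
  rewrite /projAM; apply: eq_bigr => p _.
  set t := _ ++ _; rewrite -[RHS]inA_inM_sum -[LHS]add0r; congr (_ + _).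
  have -> : t = pures ([seq (false, v) | v <- take p s] ++ (true, s`_p)
                        :: [seq (false, v) | v <- drop p.+1 s]).
    by rewrite /t !pA /pures map_cat.
  by rewrite /inA (fb _).1 // /Mdegree count_cat /= -!/(Mdegree _) !cA.
have fw := congr1 (fun h => h (pures w)) fE; rewrite addrfctE /= in fw.
split=> Mw.
  rewrite -fw /projA /projAM /=.
  rewrite multilinear_mem0 //; last by apply: pures_mem0; rewrite has_count lt0n.
  rewrite /= add0r (big_morph fst (id1 := 0) (op1 := +%R)) // big1 //.
rewrite -fw /projA /projAM /= add0r (big_morph snd (id1 := 0) (op1 := +%R)) // big1 // => p _ /=.
(* If [w] does not have exactly one entry in [M], some argument becomes [0]: either the entry at [p]
   lies in [A] and is killed by [inM], or another entry lies in [M] and is killed by [inA]. *)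
rewrite multilinear_mem0 //= mem_cat inE.
have pw : (p < size w)%N by case: p => p /=; rewrite size_map.
case: p pw => q /= _ pw.
move: Mw; rewrite -{1}(cat_take_drop q w) /Mdegree count_cat (drop_nth (false, 0) pw) /=.
case wp : (nth (false, 0) w q) => [[] v] /=; last first.
  by rewrite (nth_map (false, 0)) // wp /pure /= inM_inA eqxx !orbT.
rewrite /pures -map_take -map_drop -!/(pures _).
case: (posnP (count fst (take q w))) => [->|]; last first.
  by rewrite -has_count => /pures_mem0 ->.
case: (posnP (count fst (drop q.+1 w))) => [-> //|].
by rewrite -has_count => /pures_mem0 -> _; rewrite !orbT.
Qed.

Definition hom_pair (x : nat * (seq V -> V)) : Prop := is_hom x.1 x.2.

Definition all_hom_pair (Z : seq (nat * (seq V -> V))) : Prop :=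
  foldr (fun z P => hom_pair z /\ P) True Z.

Lemma hom_pair_chain x Z :
  hom_pair x -> all_hom_pair Z -> hom_pair (foldl (@gbracket K V) x Z).
Proof.
elim: Z x => //= z Z IH x xh [zh Zh]; apply: IH => //.
by case: x z xh zh => [m f] [n g]; apply: is_hom_bracket.
Qed.

Local Notation EA := (0%N, unary (@inA K A M)).
Local Notation EM := (0%N, unary (@inM K A M)).

(** The two projections add up to the identity, and the bracket with the identity counts the [n + 1]
    inputs minus the one output. *)
Lemma bracket_EA_EM n f : is_hom n f ->
  (gbracket (n, f) EA).2 + (gbracket (n, f) EM).2 = n%:R *: f.
Proof.
move=> fh; have [fm fa] := fh.
rewrite (bracket_unary inA_linear fh) (bracket_unary inM_linear fh).
apply/funext => s; rewrite addrACA.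
rewrite (_ : circ 0 _ f + circ 0 _ f = circ 0 (unary id) f); last first.
  apply/funext => t; rewrite addrfctE.
  have := circ_linr 1 0 (unary (@inA K A M)) (unary (@inM K A M)) t fm; rewrite scale1r.
  move=> <-; congr (circ 0 _ f t); apply/funext => -[|v [|w r]] /=; rewrite ?scaler0 ?addr0 //.
  by rewrite scale1r inA_inM_sum.
rewrite !addrfctE !opprfctE -opprD inA_inM_sum scalrfctE.
have [sn|sn] := eqVneq (size s) n.+1; last first.
  have := is_hom_circ fh (is_hom_unary (e := id) (fun a u v => erefl)).
  by rewrite addn0 => /is_hom_arity -> //; rewrite fa // scaler0 subrr.
suff -> : circ 0 (unary id) f s = f s *+ size s.
  by rewrite sn mulrS addrC addKr scaler_nat.
elim: s f fm {fh fa sn} => //= v s IH f fm.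
by rewrite take0 drop0 scale1r mulrS (IH _ (multilinear_cons v fm)).
Qed.

Lemma bracket_a_EA n f : in_a n f -> (gbracket (n, f) EA).2 = - f.
Proof.
move=> [fh fP]; rewrite (bracket_unary inA_linear fh).
have fm := is_hom_multilinear fh.
have -> : (fun s => inA (f s)) = f by rewrite -fP; apply/funext.
rewrite -[RHS]add0r; congr (_ + _); apply/funext => s.
rewrite circ_sum //; last exact: is_hom_arity (is_hom_unary inA_linear).
rewrite big1 // => -[i /= si] _; rewrite (drop_nth 0 si) /= take0 -fP projP_inA ?scaler0 //.
Qed.

Lemma bracket_Lprime_EA n f : in_Lprime n f -> (gbracket (n, f) EA).2 = n%:R *: f.
Proof.
move=> [fh fL]; rewrite -(bracket_EA_EM fh).
by have/(balanced_bracket fh) -> := (balanced_proj fh).2 fL; rewrite addr0.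
Qed.

Definition all_in_a (Z : seq (nat * (seq V -> V))) : Prop :=
  foldr (fun z P => in_a z.1 z.2 /\ P) True Z.

(* [- [_, EA]] is the derivation whose eigenvalue is the number of outputs in [A]
   minus the number of inputs in [A]: bracketing with an element of [a] shifts it
   by one, and it is [1] on [a]. *)
Lemma bracket_chain_EA (c : K) x Z : hom_pair x -> all_in_a Z ->
  (gbracket x EA).2 = c *: x.2 ->
  (gbracket (foldl (@gbracket K V) x Z) EA).2
  = (c - (size Z)%:R) *: (foldl (@gbracket K V) x Z).2.
Proof.
elim: Z x c => [|z Z IH] x c xh; first by move=> _ ->; rewrite subr0.
case=> za Za xE; rewrite -[foldl _ _ _]/(foldl (@gbracket K V) (gbracket x z) Z) (IH _ (c - 1)) //.
- by rewrite -addrA -opprD -[1]/(1%:R) -natrD add1n.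
- by case: x z xh za {xE IH} => [m f] [n g] fh [gh _]; apply: is_hom_bracket.
case: x z xh za xE {IH} => [m f] [n g] fh [gh gP] fE.
have := gbracket_jacobi fh gh (is_hom_unary inA_linear).
rewrite muln0 expr0 scale1r => ->.
have -> : gbracket (n, g) EA = (n, -1 *: g).
  by rewrite [LHS]surjective_pairing bracket_a_EA // scaleN1r /= addn0.
have -> : gbracket (m, f) EA = (m, c *: f).
  by rewrite [LHS]surjective_pairing fE /= addn0.
have /is_hom_multilinear fm := fh; have /is_hom_multilinear gm := gh.
by rewrite gbracket_Zl // gbracket_Zr // -scalerDl addrC.
Qed.

(** The chain is an eigenvector of the bracket with [EA], with eigenvalue [n - size Z]. On arguments
    in [M] the inputs contribute nothing to this bracket, so the component with values in [A] has
    eigenvalue [-1]. In characteristic 0 the two agree only for [size Z = n + 1]. *)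
Lemma projP_chain n f Z : in_Lprime n f -> all_in_a Z -> size Z != n.+1 ->
  projP (foldl (@gbracket K V) (n, f) Z).2 = 0.
Proof.
move=> fL Za sZ; have [fh _] := fL.
have Zh : all_hom_pair Z by elim: Z Za {sZ} => //= z Z IH [[zh _] /IH].
have ch := hom_pair_chain (x := (n, f)) fh Zh.
have := @bracket_chain_EA n%:R (n, f) Z fh Za (bracket_Lprime_EA fL).
move: ch; case: (foldl _ _ _) => k h hh.
rewrite (bracket_unary inA_linear hh) => hE; apply/funext => s.
have hm := is_hom_multilinear hh.
have := congr1 (fun u : seq V -> V => (u (map (@inM K A M) s)).1) hE.
rewrite /projP addrfctE opprfctE circ_sum //; last exact: is_hom_arity (is_hom_unary inA_linear).
rewrite big1 => [|[i /= si] _]; last first.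
  rewrite (drop_nth 0 si) /= take0 (nth_map 0) ?inA_inM; last by rewrite -(size_map (@inM K A M)).
  by rewrite multilinear_zero // scaler0.
rewrite add0r scalrfctE /= => /eqP; rewrite eq_sym -subr_eq0 opprK.
rewrite -[X in _ + X]scale1r -scalerDl scaler_eq0 addrAC natr1 subr_eq0.
by rewrite eqr_nat_char0 eq_sym (negbTE sZ) /= => /eqP h0; rewrite /inA h0.
Qed.

End Projections.

(** * Iterated brackets *)

Section Chains.

Variables (K : fieldType) (A M : lmodType K).
Hypothesis charK : has_pchar0 K.

Local Notation V := (A * M)%type.
Local Notation C := (seq V -> V).
Local Notation br := (@gbracket K V).
Local Notation chain := (foldl br).
Local Notation EM := (0%N, unary (@inM K A M)).

Definition odd_fst (x : nat * C) : bool := odd x.1.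

Lemma all_in_a_hom_pair (Z : seq (nat * C)) : all_in_a Z -> all_hom_pair Z.
Proof. by elim: Z => //= z Z IH [[zh _] /IH]. Qed.

Lemma br_pair (x y : nat * C) : br x y = ((x.1 + y.1)%N, (br x y).2).
Proof. exact: surjective_pairing. Qed.

Lemma br_anti (x y : nat * C) :
  (br x y).2 = (-1) ^+ (~~ (odd x.1 && odd y.1)) *: (br y x).2.
Proof. by case: x y => [m f] [n g]; rewrite gbracketC signrN -oddM signr_odd. Qed.

(** As the kernel of a derivation, [L'] is closed under linear combinations and brackets without any
    inspection of [projA] and [projAM]. *)
Lemma in_LprimeE n (f : C) : in_Lprime n f <-> is_hom n f /\ (br (n, f) EM).2 = 0.
Proof.
split=> [[fh fL]|[fh fE]]; split => //.
  by apply/(balanced_bracket charK fh)/(balanced_proj fh).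
by apply/(balanced_proj fh)/(balanced_bracket charK fh).
Qed.

Lemma multilinear_unary e : linear e -> multilinear (@unary K A M e).
Proof. by move=> /is_hom_unary /is_hom_multilinear. Qed.

Lemma in_Lprime_lin n (c : K) (f g : C) :
  in_Lprime n f -> in_Lprime n g -> in_Lprime n (c *: f + g).
Proof.
move=> /in_LprimeE[fh fE] /in_LprimeE[gh gE]; apply/in_LprimeE; split; first exact: is_hom_lin.
rewrite gbracket_linl; last exact: multilinear_unary (@inM_linear _ _ _).
by rewrite fE gE scaler0 addr0.
Qed.

Lemma in_Lprime0 n : in_Lprime n (0 : C).
Proof.
split; first exact: is_hom0.
by apply/funext => s; rewrite addrfctE /projA /projAM big1 ?addr0.
Qed.

Lemma in_Lprime_bracket m n (f g : C) : in_Lprime m f -> in_Lprime n g ->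
  in_Lprime (m + n) (br (m, f) (n, g)).2.
Proof.
move=> /in_LprimeE[fh fE] /in_LprimeE[gh gE]; apply/in_LprimeE.
split; first exact: is_hom_bracket.
rewrite -[(_, _)]/((m, f).1 + (n, g).1, _)%N -br_pair.
rewrite (gbracket_jacobi fh gh (is_hom_unary (@inM_linear _ _ _))).
rewrite (br_pair _ EM) gE [br (m, f) EM]br_pair fE.
have /is_hom_multilinear fm := fh; have /is_hom_multilinear gm := gh.
by rewrite gbracket_0r ?gbracket_0l ?scaler0 ?addr0.
Qed.

Lemma in_a_lin n (c : K) (f g : C) : in_a n f -> in_a n g -> in_a n (c *: f + g).
Proof.
by move=> [fh fP] [gh gP]; split; [exact: is_hom_lin|rewrite projP_linear fP gP].
Qed.

Lemma in_a0 n : in_a n (0 : C).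
Proof. by split; [exact: is_hom0|]. Qed.

Lemma in_a_projP n (f : C) : is_hom n f -> in_a n (projP f).
Proof. by move=> fh; split; [exact: is_hom_projP|exact: projP_idem]. Qed.

Lemma chain_fst x Z : (chain x Z).1 = (x.1 + \sum_(z <- Z) z.1)%N.
Proof.
elim: Z x => [|z Z IH] x; first by rewrite big_nil addn0.
by rewrite big_cons [LHS]IH addnA.
Qed.

Lemma odd_chain x Z : odd (chain x Z).1 = odd x.1 (+) par odd_fst Z.
Proof.
rewrite chain_fst oddD; congr (_ (+) _).
by elim: Z => [|z Z IH] /=; rewrite ?big_nil // big_cons oddD IH.
Qed.

Lemma chain_lin (c : K) m (f f' : C) Z : all_hom_pair Z ->
  (chain (m, c *: f + f') Z).2 = c *: (chain (m, f) Z).2 + (chain (m, f') Z).2.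
Proof.
elim: Z m f f' => [|z Z IH] m f f' //= [zh Zh].
rewrite [br (m, c *: f + f') z]br_pair [br (m, f) z]br_pair [br (m, f') z]br_pair.
rewrite -IH //; congr (foldl _ (_, _) Z).2.
by case: z zh => k g zh; rewrite gbracket_linl //; apply: is_hom_multilinear zh.
Qed.

Lemma chain0 m Z : all_hom_pair Z -> (chain (m, 0) Z).2 = 0.
Proof.
by move=> Zh; have := chain_lin (-1) m 0 0 Zh; rewrite scaler0 addr0 scaleN1r addNr.
Qed.

Lemma chainZ (c : K) m (f : C) Z : all_hom_pair Z ->
  (chain (m, c *: f) Z).2 = c *: (chain (m, f) Z).2.
Proof. by move=> Zh; have := chain_lin c m f 0 Zh; rewrite chain0 // !addr0. Qed.

Lemma in_a_swap x y z : hom_pair x -> in_a y.1 y.2 -> in_a z.1 z.2 ->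
  br (br x y) z = ((x.1 + z.1 + y.1)%N,
    (-1) ^+ (odd_fst y && odd_fst z) *: (br (br x z) y).2).
Proof.
case: x y z => [m f] [n g] [p h] fh ga ha; have [gh _] := ga; have [hh _] := ha.
rewrite br_pair addnAC; congr pair; rewrite gbracket_jacobi //.
rewrite [br (n, g) _]br_pair (in_a_abelian ga ha) gbracket_0r ?add0r; last exact: is_hom_multilinear fh.
by rewrite signr_nat oddM.
Qed.

Lemma chain_swap x y z Z : hom_pair x -> in_a y.1 y.2 -> in_a z.1 z.2 -> all_hom_pair Z ->
  (chain x (y :: z :: Z)).2 = (-1) ^+ (odd_fst y && odd_fst z) *: (chain x (z :: y :: Z)).2.
Proof. by move=> xh ya za Zh /=; rewrite in_a_swap // chainZ // -br_pair. Qed.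

Lemma chain_move x y Z : hom_pair x -> in_a y.1 y.2 -> all_in_a Z ->
  (chain (br x y) Z).2 = (-1) ^+ (odd_fst y && par odd_fst Z) *: (br (chain x Z) y).2.
Proof.
elim: Z x => [|z Z IH] x xh ya; first by rewrite andbF scale1r.
case=> za Za; have Zh := all_in_a_hom_pair Za.
rewrite -[LHS]/((chain x (y :: z :: Z)).2) chain_swap //.
rewrite -[(chain x _).2]/((chain (br (br x z) y) Z).2) IH //; first sgn.
by case: x z xh za => [m f] [n g] fh [gh _]; apply: is_hom_bracket.
Qed.

(** Each entry of [Z] acts as a derivation, those in [b] on [x] and those in [a] on [y]. Besides the
    Koszul sign of [unsh], [b] has to move in front of [y] and [a]. *)
Lemma chain_leibniz x y Z : hom_pair x -> hom_pair y -> all_hom_pair Z ->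
  (chain (br x y) Z).2 = unsh odd_fst Z (fun a b =>
     (-1) ^+ (par odd_fst b && (odd_fst y (+) par odd_fst a))
       *: (br (chain x b) (chain y a)).2).
Proof.
have hb (u v : nat * C) : hom_pair u -> hom_pair v -> hom_pair (br u v).
  by case: u v => [m f] [n g]; apply: is_hom_bracket.
elim: Z x y => [|z Z IH] x y xh yh; first by rewrite /= scale1r.
case=> zh Zh; rewrite -[LHS]/((chain (br (br x y) z) Z).2).
rewrite [br (br x y) z]br_pair.
have -> : (br (br x y) z).2 =
  (-1) ^+ (odd_fst y && odd_fst z) *: (br (br x z) y).2 + (br x (br y z)).2.
  case: x y z xh yh zh => [m f] [n g] [p h] fh gh hh.
  by rewrite (gbracket_jacobi fh gh hh) signr_nat oddM addrC.
rewrite chain_lin // addrC.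
have -> : chain ((br x y).1 + z.1, (br x (br y z)).2)%N Z = chain (br x (br y z)) Z.
  by rewrite [br x (br y z)]br_pair /= addnA.
have -> : chain ((br x y).1 + z.1, (br (br x z) y).2)%N Z = chain (br (br x z) y) Z.
  by rewrite [br (br x z) y]br_pair /= addnAC.
rewrite (IH x (br y z)) //; last exact: hb.
rewrite (IH (br x z) y) //; last exact: hb.
rewrite -unshZ; congr (_ + _).
  apply: eq_unsh => a b; congr (_ *: _); congr (_ ^+ nat_of_bool _).
  by rewrite /odd_fst /= oddD addbA.
apply: eq_unsh => a b; sgn.
Qed.

End Chains.

(** * Derived brackets *)

Section DerivedBrackets.

Variables (K : fieldType) (A M : lmodType K).
Hypothesis charK : has_pchar0 K.

Local Notation V := (A * M)%type.
Local Notation C := (seq V -> V).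
Local Notation U := (C * C)%type.
Local Notation H := (int * U)%type.
Local Notation br := (@gbracket K V).
Local Notation chain := (foldl br).
Local Notation W := (@graded_total K A M).
Local Notation gr := (@graded K U W).
Local Notation od := (@odd_deg K U).

Local Notation aparts := (map (@apart K A M)).

Implicit Types (x y z : H) (X Y Z : seq H).

(** Zero is homogeneous in every degree, and anything else lives in a natural degree. This form
    avoids cases on the constructors of [int]. *)
Definition L_homog (d : int) (q : C) :=
  q = 0 \/ exists2 n : nat, d + 1 = n%:Z & in_Lprime n q.
Definition a_homog (d : int) (t : C) :=
  t = 0 \/ exists2 n : nat, d = n%:Z & in_a n t.

Lemma graded_totalP d (u : U) : u \in W d <-> L_homog d u.1 /\ a_homog d u.2.
Proof.
have PoszS n : n%:Z + 1 = n.+1%:Z by rewrite -PoszD addn1.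
rewrite unfold_in; split=> [/asboolP|[uL ua]]; last apply/asboolP.
  case: d => [n|[|n]] [h1 h2]; split; try (by left); right.
  - by exists n.+1.
  - by exists n.
  by exists 0%N.
case: d uL ua => [n|[|n]] uL ua; split.
- by case: uL => [->|[k]]; [exact: in_Lprime0|rewrite PoszS => -[<-]].
- by case: ua => [->|[k [<-]]]; first exact: in_a0.
- by case: uL => [->|[k [<-]]]; first exact: in_Lprime0.
- by case: ua => [->|[]].
- by case: uL => [->|[k]].
- by case: ua => [->|[]].
Qed.

Lemma L_homog_Lprime d q : L_homog d q -> in_Lprime `|(d + 1)%R|%N q.
Proof. by case=> [->|[n ->]] //; apply: in_Lprime0. Qed.

Lemma a_homog_in_a d t : a_homog d t -> in_a `|d|%N t.
Proof. by case=> [->|[n ->]] //; apply: in_a0. Qed.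

Lemma graded_Lprime x : gr x -> in_Lprime (Lpart x).1 (Lpart x).2.
Proof. by move=> /graded_totalP[/L_homog_Lprime]. Qed.

Lemma graded_in_a x : gr x -> in_a (apart x).1 (apart x).2.
Proof. by move=> /graded_totalP[_ /a_homog_in_a]. Qed.

Lemma graded_hom_pair x : gr x -> hom_pair (Lpart x).
Proof. by case/graded_Lprime. Qed.

Lemma homogeneous_in_a X : homogeneous W X -> all_in_a (map (@apart K A M) X).
Proof. by elim: X => //= x X IH /andP[/graded_in_a ? /IH]. Qed.

Lemma homogeneous_hom_pair X : homogeneous W X -> all_hom_pair (map (@apart K A M) X).
Proof. by move=> /homogeneous_in_a /all_in_a_hom_pair. Qed.

Lemma odd_Lpart x : odd (Lpart x).1 = ~~ od x.
Proof. by rewrite /Lpart /= odd_abszD addbT. Qed.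

Lemma par_apart X : par (@odd_fst K A M) (map (@apart K A M) X) = par od X.
Proof. by elim: X => //= x X ->. Qed.

Lemma tot_deg_cons x X : tot_deg (x :: X) = x.1 + tot_deg X.
Proof. by rewrite /tot_deg big_cons. Qed.

Lemma L_homog_lin d (c : K) q q' : L_homog d q -> L_homog d q' -> L_homog d (c *: q + q').
Proof.
move=> [->|[n dn ql]] [->|[k dk ql']]; rewrite ?scaler0 ?addr0 ?add0r.
- by left.
- by right; exists k.
- right; exists n => //; rewrite -[c *: _]addr0; apply: in_Lprime_lin => //; exact: in_Lprime0.
right; exists n => //; apply: in_Lprime_lin => //.
by move: dk; rewrite dn => -[->].
Qed.

Lemma a_homog_lin d (c : K) t t' : a_homog d t -> a_homog d t' -> a_homog d (c *: t + t').
Proof.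
move=> [->|[n dn tl]] [->|[k dk tl']]; rewrite ?scaler0 ?addr0 ?add0r.
- by left.
- by right; exists k.
- right; exists n => //; rewrite -[c *: _]addr0; apply: in_a_lin => //; exact: in_a0.
right; exists n => //; apply: in_a_lin => //.
by move: dk; rewrite dn => -[->].
Qed.

Lemma a_homog_pull d X F : homogeneous W X ->
  (forall y Y, gr y -> homogeneous W Y -> tot_deg X = y.1 + tot_deg Y -> a_homog d (F y Y)) ->
  a_homog d (pull od X F).
Proof.
elim: X F => [|x X IH] F /=; first by left.
case/andP=> xg Xg FX; rewrite -[F x X]scale1r; apply: a_homog_lin.
  by apply: FX => //; rewrite tot_deg_cons.
apply: IH => // y Y yg Yg tX; rewrite -[_ *: _]addr0; apply: a_homog_lin; last by left.
apply: FX => //=; first by rewrite Yg andbT.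
by rewrite !tot_deg_cons tX addrCA.
Qed.

Lemma graded_total_submod d : GRing.submod_closed (W d).
Proof.
split=> [|a u v]; first by apply/graded_totalP; split; left.
move=> /graded_totalP[uL ua] /graded_totalP[vL va].
by apply/graded_totalP; split; [apply: L_homog_lin|apply: a_homog_lin].
Qed.

(** [apart] takes absolute values of degrees, so integer degrees add up only if no entry has
    negative degree; otherwise the component of that entry in [a] is zero, and the whole chain with
    it. *)
Lemma chain_degree (w : nat * C) X : hom_pair w -> homogeneous W X ->
  (chain w (map (@apart K A M) X)).2 = 0
  \/ ((chain w (map (@apart K A M) X)).1)%:Z = w.1%:Z + tot_deg X.
Proof.
elim: X w => [|x X IH] w wh; first by right; rewrite /tot_deg big_nil addr0.
case/andP=> xg Xg; have [xh _] := graded_in_a xg.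
have wxh : hom_pair (br w (apart x)) by case: w wh => m f fh; apply: is_hom_bracket.
case: (IH _ wxh Xg) => [|E]; first by left.
have /graded_totalP[_ [x0|[n xn _]]] := xg.
  left; rewrite /= [br w _]br_pair.
  have -> : (br w (apart x)).2 = 0.
    by case: w wh {wxh E} => m f fh; rewrite /apart x0 gbracket_0r //; apply: is_hom_multilinear fh.
  exact: (chain0 _ (homogeneous_hom_pair Xg)).
by right; rewrite /= E /apart /= tot_deg_cons xn PoszD addrA.
Qed.

(* The operation [l_k (Q[1], theta_1, ..., theta_(k-1))], for [Q] in [x] and
   [theta_i] in [Y]. *)
Definition derived x Y : C := projP (chain (Lpart x) (map (@apart K A M) Y)).2.

Lemma chain_derived_degree x Y : gr x -> homogeneous W Y ->
  (chain (Lpart x) (map (@apart K A M) Y)).2 = 0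
  \/ ((chain (Lpart x) (map (@apart K A M) Y)).1)%:Z = x.1 + 1 + tot_deg Y.
Proof.
move=> xg Yg; have xh := graded_hom_pair xg.
case: (chain_degree xh Yg) => [|->]; first by left.
have /graded_totalP[[x0|[n xn _]] _] := xg; last by right; rewrite /Lpart /= xn.
left; rewrite /Lpart x0; exact: (chain0 _ (homogeneous_hom_pair Yg)).
Qed.

Lemma derived_a_homog x Y : gr x -> homogeneous W Y ->
  a_homog (tot_deg (x :: Y) + 1) (derived x Y).
Proof.
move=> xg Yg; rewrite /derived.
have := hom_pair_chain (graded_hom_pair xg) (homogeneous_hom_pair Yg).
case: (chain_derived_degree xg Yg) => [-> _|E ch]; first by left.
right; eexists; last by apply: in_a_projP; exact: ch.
by rewrite E tot_deg_cons addrAC.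
Qed.

Lemma derived_nil x : gr x -> derived x [::] = 0.
Proof. by move=> /graded_Lprime xl; rewrite /derived (projP_chain charK xl). Qed.

Lemma Lops_derived X : homogeneous W X -> (Lops X).2 = pull od X derived.
Proof.
move=> Xg; rewrite (pull_nth _ (0 : H)) /=.
have E : \sum_(p < size X) (-1) ^ ((X`_p).1 * tot_deg (take p X)) *:
      projP (foldl br (Lpart X`_p) (map (@apart K A M) (take p X ++ drop p.+1 X))).2
    = \sum_(i < size X) (-1) ^+ (od X`_i && par od (take i X)) *:
      derived X`_i (take i X ++ drop i.+1 X).
  by apply: eq_bigr => p _; rewrite expN1_mulz par_tot_deg.
case: ltnP => sX; first exact: E.
(* For a single argument [Lops] is zero by definition, whereas [pull] gives the projection of an
   element of [L'], which vanishes by [derived_nil]. *)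
case: X sX Xg {E} => [|x [|y X]] // _; first by rewrite big_ord0.
by case/andP=> xg _; rewrite big_ord1 /= derived_nil ?scaler0.
Qed.

Lemma derived_linl (c : K) d (u v : U) Y : homogeneous W Y ->
  derived (d, c *: u + v) Y = c *: derived (d, u) Y + derived (d, v) Y.
Proof.
move=> Yg; rewrite /derived -projP_linear /Lpart /=.
by rewrite chain_lin //; apply: homogeneous_hom_pair.
Qed.

Lemma derived_linr (c : K) x d (u v : U) Y Z : gr x -> homogeneous W Y -> homogeneous W Z ->
  derived x (Y ++ (d, c *: u + v) :: Z)
  = c *: derived x (Y ++ (d, u) :: Z) + derived x (Y ++ (d, v) :: Z).
Proof.
move=> xg Yg Zg; rewrite /derived -projP_linear !map_cat !foldl_cat /=.
have := hom_pair_chain (graded_hom_pair xg) (homogeneous_hom_pair Yg).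
case: (chain _ _) => m f fh; have fm := is_hom_multilinear fh.
have -> : br (m, f) (apart (d, c *: u + v)) = ((m + `|d|)%N,
    c *: (br (m, f) (apart (d, u))).2 + (br (m, f) (apart (d, v))).2).
  by rewrite [LHS]br_pair; congr pair; apply: gbracket_linr.
by rewrite chain_lin //; apply: homogeneous_hom_pair.
Qed.

Lemma derived_swap x Y y z Z : gr x -> homogeneous W Y -> gr y -> gr z -> homogeneous W Z ->
  derived x (Y ++ y :: z :: Z) = (-1) ^+ (od y && od z) *: derived x (Y ++ z :: y :: Z).
Proof.
move=> xg Yg yg zg Zg; rewrite /derived -projPZ !map_cat !foldl_cat.
have ch := hom_pair_chain (graded_hom_pair xg) (homogeneous_hom_pair Yg).
congr projP; apply: (chain_swap ch (graded_in_a yg) (graded_in_a zg)).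
exact: homogeneous_hom_pair.
Qed.

Lemma Lops_fst2 x y :
  (Lops [:: x; y] : U).1 = (-1) ^+ (~~ od x) *: (br (Lpart x) (Lpart y)).2.
Proof. by rewrite -odd_Lpart signr_odd. Qed.

Lemma Lpart_bracket_degree x y : gr x -> gr y -> (br (Lpart x) (Lpart y)).2 = 0
  \/ x.1 + y.1 + 1 + 1 = ((Lpart x).1 + (Lpart y).1)%:Z.
Proof.
move=> xg yg; have [xh yh] := (graded_hom_pair xg, graded_hom_pair yg).
have xm := is_hom_multilinear xh; have ym := is_hom_multilinear yh.
have /graded_totalP[[x0|[n xn xl]] _] := xg; first by left; rewrite /Lpart x0 gbracket_0l.
have /graded_totalP[[y0|[k yk yl]] _] := yg; first by left; rewrite {2}/Lpart y0 gbracket_0r.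
by right; rewrite /Lpart xn yk PoszD -addrA addrACA xn yk.
Qed.

Lemma Lops_homogeneous X : homogeneous W X -> Lops X \in W (tot_deg X + 1).
Proof.
move=> Xg; apply/graded_totalP; split; last first.
  rewrite Lops_derived //.
  apply: a_homog_pull => // y Y yg Yg tX.
  by rewrite tX -tot_deg_cons; apply: derived_a_homog.
case: X Xg => [|x [|y [|z X]]] Xg; try by left.
case/and3P: Xg => xg yg _; have [xh yh] := (graded_hom_pair xg, graded_hom_pair yg).
rewrite Lops_fst2 !tot_deg_cons /tot_deg big_nil addr0.
case: (Lpart_bracket_degree xg yg) => [->|E]; first by left; rewrite scaler0.
right; exists ((Lpart x).1 + (Lpart y).1)%N => //.
rewrite -[_ *: _]addr0; apply: in_Lprime_lin => //; last exact: in_Lprime0.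
exact: (in_Lprime_bracket charK (graded_Lprime xg) (graded_Lprime yg)).
Qed.

Lemma Lops_fst_size X : size X != 2%N -> (Lops X : U).1 = 0.
Proof. by case: X => [|x [|y [|z X]]]. Qed.

Lemma Lops_multilinear X Y d (c : K) (u v : U) :
  homogeneous W X -> homogeneous W Y -> u \in W d -> v \in W d ->
  Lops (X ++ (d, c *: u + v) :: Y) = c *: Lops (X ++ (d, u) :: Y) + Lops (X ++ (d, v) :: Y).
Proof.
move=> Xg Yg ug vg; have uvg : c *: u + v \in W d by have [_] := graded_total_submod d; apply.
have XYg (w : U) : w \in W d -> homogeneous W (X ++ (d, w) :: Y).
  by move=> wg; rewrite homogeneous_cat Xg /= wg.
suff [e1 e2] :
     (Lops (X ++ (d, c *: u + v) :: Y) : U).1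
       = c *: (Lops (X ++ (d, u) :: Y) : U).1 + (Lops (X ++ (d, v) :: Y) : U).1
  /\ (Lops (X ++ (d, c *: u + v) :: Y) : U).2
       = c *: (Lops (X ++ (d, u) :: Y) : U).2 + (Lops (X ++ (d, v) :: Y) : U).2.
  exact: injective_projections.
split; last first.
  rewrite !Lops_derived ?XYg //.
  apply: (pull_multilinear (P := gr)) => // [Z Zg|w Z Z' wg Zg Zg'].
    exact: derived_linl.
  exact: derived_linr.
have szE (w : U) : size (X ++ (d, w) :: Y) = (size X + size Y).+1.
  by rewrite size_cat addnS.
have [sXY|sXY] := eqVneq (size X + size Y)%N 1%N; last first.
  by rewrite !Lops_fst_size ?szE ?eqSS // scaler0 addr0.
case: X {XYg} szE sXY Xg => [|x [|x' X]] szE sXY Xg;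
  case: Y Yg {szE} sXY => [|y [|y' Y]] Yg sXY //.
  rewrite ![[::] ++ _]/= !Lops_fst2 scalerA mulrC -scalerA -scalerDr; congr (_ *: _).
  case/andP: Yg => /(graded_hom_pair (x := y)) /is_hom_multilinear ym _.
  exact: gbracket_linl.
rewrite !cat1s !Lops_fst2 scalerA mulrC -scalerA -scalerDr; congr (_ *: _).
case/andP: Xg => /(graded_hom_pair (x := x)) /is_hom_multilinear xm _.
exact: gbracket_linr.
Qed.

Lemma Lops_symmetric : symmetric_on od gr (@Lops K A M).
Proof.
move=> X x y Y Xg xg yg Yg.
have Xg2 u v : gr u -> gr v -> homogeneous W (X ++ u :: v :: Y).
  move=> ug vg; rewrite homogeneous_cat; apply/andP; split; first exact: Xg.
  by apply/and3P; split.
suff [e1 e2] :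
     (Lops (X ++ x :: y :: Y) : U).1
       = (-1) ^+ (od x && od y) *: (Lops (X ++ y :: x :: Y) : U).1
  /\ (Lops (X ++ x :: y :: Y) : U).2
       = (-1) ^+ (od x && od y) *: (Lops (X ++ y :: x :: Y) : U).2.
  exact: injective_projections.
split; last first.
  rewrite !Lops_derived ?Xg2 //.
  apply: (pull_swap (P := gr)) => // z Z Z' zg Zg Zg'; exact: derived_swap.
have [sXY|sXY] := eqVneq (size X + size Y)%N 0%N; last first.
  by rewrite !Lops_fst_size ?scaler0 // size_cat /= !addnS !eqSS.
case: X sXY {Xg Xg2} => // sXY; case: Y sXY {Yg} => // _.
rewrite ![[::] ++ _]/= !Lops_fst2 br_anti !odd_Lpart; sgn.
Qed.

Lemma Lops_nested_fst x y z : gr x -> gr y -> gr z ->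
  (Lops [:: (tot_deg [:: x; y] + 1, Lops [:: x; y]); z] : U).1 =
  (-1) ^+ (~~ od y) *: (br (br (Lpart x) (Lpart y)) (Lpart z)).2.
Proof.
move=> xg yg zg; have zm := is_hom_multilinear (graded_hom_pair zg).
rewrite Lops_fst2 {1}/Lpart.
have -> : tot_deg [:: x; y] = x.1 + y.1 by rewrite !tot_deg_cons /tot_deg big_nil addr0.
rewrite Lops_fst2 gbracket_Zl // scalerA -signr_addb.
have -> : od (x.1 + y.1 + 1, Lops [:: x; y]) = ~~ (od x (+) od y).
  by rewrite /odd_deg /= !odd_abszD addbT.
congr (_ ^+ nat_of_bool _ *: _); first by bool_ring.
case: (Lpart_bracket_degree xg yg) => E; last by rewrite E [br (Lpart x) _]br_pair.
by rewrite [br (Lpart x) _]br_pair E !gbracket_0l.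
Qed.

(** Only [l_2] has a component in [L'[1]], and it depends only on the components in [L']. So three
    arguments are the only nontrivial case, and there the factor [(-1)^|Q|] turns the graded Lie
    identity into the symmetric one. *)
Lemma Lops_jacobi_fst X : homogeneous W X ->
  unsh od X (fun a b => (Lops ((tot_deg a + 1, Lops a) :: b) : U).1) = 0.
Proof.
move=> Xg; have F0 a b : homogeneous W b -> (size a == 2%N) && (size b == 1%N) = false ->
    (Lops ((tot_deg a + 1, Lops a) :: b) : U).1 = 0.
  move=> bg; have [sb|sb] := eqVneq (size b) 1%N; last by move=> _; rewrite Lops_fst_size.
  rewrite andbT => /negbT sa; case: b sb bg => // z [|z' b] // _ /andP[zg _].
  rewrite Lops_fst2 /Lpart Lops_fst_size // gbracket_0l ?scaler0 //.
  exact: (is_hom_multilinear (graded_hom_pair (x := z) zg)).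
have [sX|sX] := eqVneq (size X) 3%N; last first.
  transitivity (unsh od X (fun _ _ => 0 : C)); last exact: unsh0.
  apply: (@eq_unsh_all _ _ _ _ gr); [exact: Xg|move=> a b ag bg sab].
  by apply: F0 => //; apply: contraNF sX => /andP[/eqP sa /eqP sb]; rewrite -sab sa sb.
case: X sX Xg => [|x [|y [|z [|? X]]]] // _ /and4P[xg yg zg _].
rewrite unsh3 //; try by apply: F0; rewrite ?/homogeneous /= ?xg ?yg ?zg.
rewrite !Lops_nested_fst //.
have [[xh yh] zh] := (graded_hom_pair xg, graded_hom_pair yg, graded_hom_pair zg).
have J := gbracket_jacobi xh yh zh.
rewrite -!surjective_pairing in J; rewrite J.
have -> : (br (Lpart x) (br (Lpart y) (Lpart z))).2
  = (-1) ^+ (~~ (~~ od x && (od y (+) od z))) *: (br (br (Lpart y) (Lpart z)) (Lpart x)).2.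
  by rewrite br_anti oddD !odd_Lpart; congr (_ ^+ nat_of_bool _ *: _); bool_ring.
rewrite [(-1) ^+ (_ * _)]signr_nat oddM !odd_Lpart.
set B1 := (br (br (Lpart x) _) _).2; set B2 := (br (br (Lpart y) _) _).2.
move: B1 B2 => B1 B2.
case: (od x); case: (od y); case: (od z); rewrite /= ?expr0 ?expr1 ?scale1r ?scaleN1r; zmod.
Qed.

(* [derived y ((d, (q, t)) :: b)], for [k] the absolute value of [d]. *)
Definition plug y (k : nat) (t : C) b : C := projP (chain (br (Lpart y) (k, t)) (aparts b)).2.

(** The sum over [I] and [J] of [l(Q, l(Q', theta_I), theta_J)], with [Q] from [y] and [Q'] from
    [z]. *)
Definition nested y z Z : C :=
  unsh od Z (fun a b => plug y `|(z.1 + tot_deg a + 1)%R|%N (derived z a) b).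

Lemma plug_linear y k b : gr y -> homogeneous W b -> linear (fun t => plug y k t b).
Proof.
move=> yg bg c t t'; rewrite /plug -projP_linear.
have ym := is_hom_multilinear (graded_hom_pair yg).
have -> : br (Lpart y) (k, c *: t + t') = (((Lpart y).1 + k)%N,
    c *: (br (Lpart y) (k, t)).2 + (br (Lpart y) (k, t')).2).
  by rewrite [LHS]br_pair; congr pair; apply: gbracket_linr.
by rewrite chain_lin //; apply: homogeneous_hom_pair.
Qed.

Lemma plug0 y k b : gr y -> homogeneous W b -> plug y k 0 b = 0.
Proof.
move=> yg bg; have := plug_linear k yg bg (-1) 0 0.
by rewrite scaler0 addr0 scaleN1r addNr.
Qed.

(** Elements of [a] commute inside a chain up to sign, so the inner derived bracket can be moved
    behind [b], into the shape of the terms of [projP_bracket]. The two ways of writing its degree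
    agree unless it is zero. *)
Lemma plug_derived y z a b : gr y -> gr z -> homogeneous W a -> homogeneous W b ->
  plug y `|(z.1 + tot_deg a + 1)%R|%N (derived z a) b
  = (-1) ^+ ((~~ od z (+) par od a) && par od b) *:
    projP (br (chain (Lpart y) (aparts b)) ((chain (Lpart z) (aparts a)).1, derived z a)).2.
Proof.
move=> yg zg ag bg; set k := (chain (Lpart z) _).1.
have zh := hom_pair_chain (graded_hom_pair zg) (homogeneous_hom_pair ag).
have -> : plug y `|(z.1 + tot_deg a + 1)%R|%N (derived z a) b = plug y k (derived z a) b.
  rewrite /k /derived; case: (chain_derived_degree zg ag) => [->|E].
    by rewrite projP0 !plug0.
  by rewrite addrAC -E.
rewrite /plug (chain_move (y := (k, derived z a)) (graded_hom_pair yg) (in_a_projP zh)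
  (homogeneous_in_a bg)) projPZ.
by rewrite par_apart /odd_fst /= odd_chain odd_Lpart par_apart.
Qed.

Lemma derived_bracket x y Z : gr x -> gr y -> homogeneous W Z ->
  projP (chain (br (Lpart x) (Lpart y)) (aparts Z)).2
  = nested x y Z + (-1) ^+ (~~ (~~ od x && ~~ od y)) *: nested y x Z.
Proof.
move=> xg yg Zg; have [xh yh] := (graded_hom_pair xg, graded_hom_pair yg).
rewrite chain_leibniz //; last exact: homogeneous_hom_pair.
rewrite (unsh_map (p := od)) // (unsh_morph _ (@projP_linear K A M)).
(* In the Leibniz expansion [a] acts on [y] and [b] on [x], so the terms of [nested y x Z] match
   only after exchanging the two sublists. *)
rewrite /nested -[unsh _ _ (fun a b => plug y _ _ _)]unsh_swap -unshZ -unshD.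
apply: (@eq_unsh_all _ _ _ _ gr); [exact: Zg|move=> a b ag bg _].
have hX := hom_pair_chain xh (homogeneous_hom_pair bg).
have hY := hom_pair_chain yh (homogeneous_hom_pair ag).
rewrite projPZ !par_apart.
have := projP_bracket hX hY; rewrite -!surjective_pairing => ->.
rewrite !plug_derived // scalerDr; congr (_ + _).
  by congr (_ *: _); rewrite /odd_fst odd_Lpart andbC.
rewrite [(br (_, projP _) _).2]br_anti projPZ !scalerA -!signr_addb.
congr (_ ^+ nat_of_bool _ *: projP _).
by rewrite [odd_fst _]odd_Lpart ![(_, _).1]/= !odd_chain !odd_Lpart !par_apart; bool_ring.
Qed.

Lemma derived_Lops a b : homogeneous W a -> homogeneous W b ->
  derived (tot_deg a + 1, Lops a) b =
  (if a is [:: u; v] then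
     (-1) ^+ (~~ od u) *: projP (chain (br (Lpart u) (Lpart v)) (aparts b)).2 else 0).
Proof.
move=> ag bg; have bh := homogeneous_hom_pair bg.
case: a ag => [|u [|v [|w a]]] ag; try by rewrite /derived /Lpart Lops_fst_size // chain0.
case/and3P: ag => ug vg _.
rewrite /derived {1}/Lpart Lops_fst2 chainZ // projPZ; congr (_ *: projP _).
have -> : tot_deg [:: u; v] = u.1 + v.1 by rewrite !tot_deg_cons /tot_deg big_nil addr0.
rewrite [X in _ = (chain X _).2]br_pair.
by case: (Lpart_bracket_degree ug vg) => E; rewrite E // !chain0.
Qed.

Lemma derived_cons_Lops z a b : gr z -> homogeneous W a -> homogeneous W b ->
  derived z ((tot_deg a + 1, Lops a) :: b) =
  pull od a (fun z' a' => plug z `|(z'.1 + tot_deg a' + 1)%R|%N (derived z' a') b).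
Proof.
move=> zg ag bg.
rewrite -[LHS]/(plug z `|(tot_deg a + 1)%R|%N (Lops a : U).2 b) Lops_derived //.
rewrite (pull_morph _ (plug_linear _ zg bg)).
apply: (eq_pull_tot (P := gr)); first exact: ag.
by move=> y Y yg Yg ->.
Qed.

Lemma Lops_jacobi_snd X : homogeneous W X ->
  unsh od X (fun a b => (Lops ((tot_deg a + 1, Lops a) :: b) : U).2) = 0.
Proof.
move=> Xg.
(* The outer operation takes its element of [L'] either from the inner result, which forces the
   inner operation to be [l_2] on [L'], or from an entry of [b]; in the latter case the inner result
   enters through its component in [a]. *)
transitivity (unsh od X (fun a b =>
  (if a is [:: u; v] then
     (-1) ^+ (~~ od u) *: projP (chain (br (Lpart u) (Lpart v)) (aparts b)).2 else 0)
  + pull od b (fun z Z => (-1) ^+ (~~ par od a && od z) *: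
      pull od a (fun z' a' => plug z `|(z'.1 + tot_deg a' + 1)%R|%N (derived z' a') Z)))).
  apply: (@eq_unsh_all _ _ _ _ gr); [exact: Xg|move=> a b ag bg _].
  have yg : gr (tot_deg a + 1, Lops a) by apply: Lops_homogeneous.
  rewrite Lops_derived //; last exact/andP.
  rewrite -[LHS]/(derived _ b + pull od b _) derived_Lops //; congr (_ + _).
  apply: (eq_pull_all (P := gr)) => [|z Z zg Zg _ _]; first exact: bg.
  rewrite derived_cons_Lops //; congr (_ ^+ nat_of_bool (_ && _) *: _).
  by rewrite /odd_deg /= odd_abszD addbT par_tot_deg.
rewrite unshD unsh_pullr.
have -> : pull od X (fun y Y => unsh od Y (fun a b => (-1) ^+ (od y && par od a) *:
     ((-1) ^+ (~~ par od a && od y) *: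
      pull od a (fun z' a' => plug y `|(z'.1 + tot_deg a' + 1)%R|%N (derived z' a') b))))
  = pull od X (fun y Y => pull od Y (fun z Z => (-1) ^+ od y *: nested y z Z)).
  apply: eq_pull => y Y; rewrite pullZ -unsh_pulll -unshZ; apply: eq_unsh => a b.
  by sgn.
(* The pairs pulled in both orders are the two nested sums of [derived_bracket], which cancel
   against the terms whose first part has two entries. *)
rewrite -unsh_pair -unshD.
transitivity (unsh od X (fun _ _ => 0 : C)); last exact: unsh0.
apply: (@eq_unsh_all _ _ _ _ gr); [exact: Xg|move=> a b ag bg _].
case: a ag => [|u [|v [|w a]]] ag; rewrite ?addr0 //.
case/and3P: ag => ug vg _; rewrite derived_bracket //.
set N1 := nested _ _ _; set N2 := nested _ _ _; move: N1 N2 => N1 N2.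
by case: (od u); case: (od v); rewrite /= ?expr0 ?expr1 ?scale1r ?scaleN1r; zmod.
Qed.

Lemma Lops_list_Linfty1 : list_Linfty1 W (@Lops K A M).
Proof.
split.
- exact: graded_total_submod.
- by rewrite /Lops.
- exact: Lops_homogeneous.
- by move=> X Y d c u v; apply: Lops_multilinear.
- exact: Lops_symmetric.
move=> X Xg; apply: injective_projections.
  rewrite (unsh_morph _ (h := fst)) //; exact: Lops_jacobi_fst.
rewrite (unsh_morph _ (h := snd)) //; exact: Lops_jacobi_snd.
Qed.

(** A derived bracket of [Q] needs exactly [|Q| + 1] elements of [a], hence at most [N + 2]
    arguments in all; the component in [L'[1]] needs exactly two. *)
Lemma Lops_vanish X N : homogeneous W X -> all (fun x => (Lpart x).1 <= N)%N X ->
  (N + 2 < size X)%N -> (2 < size X)%N -> Lops X = 0.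
Proof.
move=> Xg XN sN s2; apply: injective_projections.
  by rewrite Lops_fst_size // neq_ltn s2 orbT.
rewrite Lops_derived //.
transitivity (pull od X (fun _ _ => 0 : C)); last exact: pull0.
apply: (eq_pull_all (P := fun x => gr x && ((Lpart x).1 <= N)%N)).
  by rewrite all_predI; apply/andP.
move=> y Y /andP[yg yN] YP sY _.
have Yg : homogeneous W Y by apply: sub_all YP => x /andP[].
rewrite /derived; have yl := graded_Lprime yg.
rewrite [Lpart y]surjective_pairing (projP_chain charK yl) ?size_map //.
  exact: homogeneous_in_a.
rewrite neq_ltn; apply/orP; right.
by move: sN; rewrite sY addn2 ltnS; apply: leq_trans; rewrite ltnS.
Qed.

Lemma Lops_nilpotent alpha X : alpha \in W 0 -> homogeneous W X ->
  exists N, forall n, (N <= n)%N -> Lops (nseq n (0 : int, alpha) ++ X) = 0.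
Proof.
(* The initial value [1] accounts for [alpha]: in degree 0 the component in [L'] has degree 1. *)
move=> ag Xg; pose N := foldr (fun x n => maxn (Lpart x).1 n) 1%N X.
have XN : all (fun x => (Lpart x).1 <= N)%N X.
  rewrite /N; elim: X {Xg N} => //= x X IH; rewrite leq_maxl /=.
  by apply: sub_all IH => y /leq_trans -> //; apply: leq_maxr.
have N1 : (1 <= N)%N by rewrite /N; elim: X {Xg N XN} => //= x X IH; rewrite leq_max IH orbT.
exists (N + 3)%N => n Nn; apply: (@Lops_vanish _ N).
- by rewrite homogeneous_cat homogeneous_nseq.
- by rewrite all_cat XN andbT all_nseq /Lpart /= N1 orbT.
- by rewrite size_cat size_nseq ltn_addr // -addnS.
by rewrite size_cat size_nseq ltn_addr // (leq_trans _ Nn) // leq_addl.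
Qed.

End DerivedBrackets.

(** * Relative Rota-Baxter algebras *)

Section Bilinear.

Variables (K : fieldType) (X Y Z : lmodType K) (f : X -> Y -> Z).
Hypothesis f_bilinear : is_bilinear f.

Lemma bilinear_linl c u u' y : f (c *: u + u') y = c *: f u y + f u' y.
Proof. by case: f_bilinear => _ /(_ y c u u'). Qed.

Lemma bilinear_linr c x v v' : f x (c *: v + v') = c *: f x v + f x v'.
Proof. by case: f_bilinear => /(_ x c v v'). Qed.

Lemma bilinear0l y : f 0 y = 0.
Proof. by have := bilinear_linl (-1) 0 0 y; rewrite scaler0 addr0 scaleN1r addNr. Qed.

Lemma bilinear0r x : f x 0 = 0.
Proof. by have := bilinear_linr (-1) x 0 0; rewrite scaler0 addr0 scaleN1r addNr. Qed.

End Bilinear.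

Lemma bilinearD (K : fieldType) (X Y Z : lmodType K) (f g : X -> Y -> Z) :
  is_bilinear f -> is_bilinear g -> is_bilinear (fun x y => f x y + g x y).
Proof.
move=> fb gb; split=> [x c v v'|y c u u'].
  by rewrite (bilinear_linr fb) (bilinear_linr gb) scalerDr addrACA.
by rewrite (bilinear_linl fb) (bilinear_linl gb) scalerDr addrACA.
Qed.

Section StructureElement.

Variables (K : fieldType) (A M : lmodType K).
Hypothesis charK : has_pchar0 K.

Local Notation V := (A * M)%type.
Local Notation C := (seq V -> V).
Local Notation U := (C * C)%type.
Local Notation br := (@gbracket K V).
Local Notation W := (@graded_total K A M).

Variables (mu : A -> A -> A) (l : A -> M -> M) (r : M -> A -> M) (T : M -> A).
Hypotheses (mub : is_bilinear mu) (lb : is_bilinear l) (rb : is_bilinear r) (Tl : linear T).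

(** The product of the square-zero extension of [A] by [M], in which [M] multiplies with itself to
    zero; it is the cochain [pi]. *)
Definition square_zero_product : C := fun s =>
  if s is [:: u; v] then (mu u.1 v.1, l u.1 v.2 + r u.2 v.1) else 0.

Local Notation P2 := square_zero_product.
Local Notation TV := (ext_M (A := A) T).
Local Notation alpha := (structure_element mu l r T).

Lemma structure_elementE : alpha = (P2, TV).
Proof.
congr pair; apply/funext => -[|u [|v [|w s]]] //=; rewrite !addrfctE /= ?addr0 //.
by apply: injective_projections; rewrite /= ?addr0 ?add0r.
Qed.

Let T0 : T 0 = 0.
Proof. by have := Tl (-1) 0 0; rewrite scaler0 addr0 scaleN1r addNr. Qed.

Let TD m n : T (m + n) = T m + T n.
Proof. by have := Tl 1 m n; rewrite !scale1r. Qed.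

Lemma is_hom_product : is_hom 1 P2.
Proof.
split=> [|[|u [|v [|w s]]]] //.
move=> [|w1 [|w2 [|w3 s1]]] [|z1 [|z2 s2]] c u v; rewrite /= ?scaler0 ?addr0 //.
  apply: injective_projections; rewrite /= ?(bilinear_linl mub) //.
  by rewrite (bilinear_linl lb) (bilinear_linl rb) scalerDr addrACA.
apply: injective_projections; rewrite /= ?(bilinear_linr mub) //.
by rewrite (bilinear_linr lb) (bilinear_linr rb) scalerDr addrACA.
Qed.

Lemma in_Lprime_product : in_Lprime 1 P2.
Proof.
split; first exact: is_hom_product.
apply/(balanced_proj is_hom_product) => -[|[b u] [|[b' v] [|? w]]] //=.
rewrite /pure /Mdegree; case: b; case: b' => /=;
  by rewrite ?(bilinear0l mub) ?(bilinear0r mub) ?(bilinear0l lb) ?(bilinear0r lb)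
     ?(bilinear0l rb) ?(bilinear0r rb) ?addr0 ?add0r.
Qed.

Lemma in_a_operator : in_a 0 TV.
Proof.
split; last by apply/funext => -[|u [|v s]].
split=> [|[|u [|v s]]] //.
move=> [|w1 [|w2 s1]] [|z1 s2] c u v; rewrite /= ?scaler0 ?addr0 //.
by apply: injective_projections; rewrite /= ?Tl ?scaler0 ?addr0.
Qed.

Lemma structure_element_graded : alpha \in W 0.
Proof.
rewrite structure_elementE; apply/graded_totalP; split; right.
  by exists 1%N => //; exact: in_Lprime_product.
by exists 0%N => //; exact: in_a_operator.
Qed.

(** In degree 1 the bracket of [pi] with itself is twice the associator of the square-zero product,
    and that product is associative exactly when the four axioms hold. *)
Lemma product_square_eq0 : (br (1%N, P2) (1%N, P2)).2 = 0 <->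
  [/\ associative mu,
      forall a b m, l (mu a b) m = l a (l b m),
      forall m a b, r m (mu a b) = r (r m a) b &
      forall a m b, r (l a m) b = l a (r m b)].
Proof.
have brE : (br (1%N, P2) (1%N, P2)).2 = gdot 1 1 P2 P2 *+ 2.
  by rewrite /gbracket /= expr1 scaleN1r opprK mulr2n.
have gE u v w : gdot 1 1 P2 P2 [:: u; v; w] =
  (mu (mu u.1 v.1) w.1 - mu u.1 (mu v.1 w.1),
   (l (mu u.1 v.1) w.2 + r (l u.1 v.2 + r u.2 v.1) w.1)
   - (l u.1 (l v.1 w.2 + r v.2 w.1) + r u.2 (mu v.1 w.1))).
  rewrite /gdot !big_ord_recl big_ord0 /= expr0 expr1 scale1r scaleN1r addr0.
  by [].
split=> [E|[ma lA rA lr]].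
  have E3 u v w : gdot 1 1 P2 P2 [:: u; v; w] = 0.
    apply: (mulrn_char0 charK (n := 2)) => //.
    by rewrite -[RHS]/((0 : C) [:: u; v; w]) -E brE natmulfctE.
  have E1 u v w := congr1 fst (E3 u v w); have E2 u v w := congr1 snd (E3 u v w).
  (* Three arguments in [A] give associativity of [mu]; a single argument in [M], placed last, first
     or in the middle, isolates one bimodule axiom each. *)
  split.
  - move=> a b c; have := E1 (a, 0) (b, 0) (c, 0); rewrite gE /= => /eqP.
    by rewrite subr_eq0 => /eqP ->.
  - move=> a b m; have := E2 (a, 0) (b, 0) (0, m); rewrite gE /= => /eqP.
    rewrite ?(bilinear0l rb) ?(bilinear0r lb) ?(bilinear0r rb) ?addr0 subr_eq0.
    by move/eqP.
  - move=> m a b; have := E2 (0, m) (a, 0) (b, 0); rewrite gE /= => /eqP.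
    rewrite ?(bilinear0l lb) ?(bilinear0r lb) ?(bilinear0l rb) ?add0r subr_eq0.
    by move/eqP.
  move=> a m b; have := E2 (a, 0) (0, m) (b, 0); rewrite gE /= => /eqP.
  rewrite ?(bilinear0l lb) ?(bilinear0r lb) ?(bilinear0l rb) ?addr0 ?add0r subr_eq0.
  by move/eqP.
rewrite brE; suff -> : gdot 1 1 P2 P2 = 0 by rewrite mul0rn.
have h := is_hom_circ is_hom_product is_hom_product.
apply/funext => -[|u [|v [|w [|x s]]]]; try by rewrite (gdotE is_hom_product is_hom_product) h.2.
rewrite gE; apply: injective_projections => /=; first by rewrite ma subrr.
have rD x y b : r (x + y) b = r x b + r y b.
  by have := bilinear_linl rb 1 x y b; rewrite !scale1r.
have lD a x y : l a (x + y) = l a x + l a y.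
  by have := bilinear_linr lb 1 a x y; rewrite !scale1r.
by rewrite lA rA rD lD lr addrA subrr.
Qed.

Lemma operator_eq0 :
  projP (br (br (1%N, P2) (0%N, TV)) (0%N, TV)).2 = 0 <->
  forall m n, mu (T m) (T n) = T (l (T m) n + r m (T n)).
Proof.
set D := (br _ _).2.
have g10 (f g : C) u v : gdot 1 0 f g [:: u; v] = f [:: g [:: u]; v] + f [:: u; g [:: v]].
  by rewrite /gdot !big_ord_recl big_ord0 /= !muln0 expr0 !scale1r addr0.
have g01 (f g : C) u v : gdot 0 1 g f [:: u; v] = g [:: f [:: u; v]].
  by rewrite /gdot big_ord1 /= expr0 scale1r.
pose B := (br (1%N, P2) (0%N, TV)).2.
have BE u v : B [:: u; v] = P2 [:: TV [:: u]; v] + P2 [:: u; TV [:: v]] - TV [:: P2 [:: u; v]].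
  rewrite -[LHS]/(gdot 1 0 P2 TV [:: u; v] - (-1) ^+ (1 * 0) *: gdot 0 1 TV P2 [:: u; v]).
  by rewrite g10 g01 muln0 expr0 scale1r.
have DE u v : D [:: u; v] = B [:: TV [:: u]; v] + B [:: u; TV [:: v]] - TV [:: B [:: u; v]].
  rewrite -[LHS]/(gdot 1 0 B TV [:: u; v] - (-1) ^+ (1 * 0) *: gdot 0 1 TV B [:: u; v]).
  by rewrite g10 g01 muln0 expr0 scale1r.
(* The factor 2: [T] enters both slots of [pi] in two orders, and each term with one inner and one
   outer [T] arises from either order of bracketing. *)
have PDE (u v : V) : projP D [:: u; v] =
    ((mu (T u.2) (T v.2) - T (l (T u.2) v.2 + r u.2 (T v.2))) *+ 2, 0).
  apply: injective_projections => //.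
  rewrite -[LHS]/((D [:: inM u; inM v]).1) DE !BE /= ?T0 ?(bilinear0l mub) ?(bilinear0r mub) ?(bilinear0l lb).
  rewrite ?(bilinear0r lb) ?(bilinear0l rb) ?(bilinear0r rb) ?addr0 ?add0r ?sub0r ?subr0.
  by rewrite !TD mulr2n; zmod.
have Dh : is_hom 1 D.
  apply: (is_hom_bracket (m := 1) (n := 0)); last by case: in_a_operator.
  by apply: (is_hom_bracket is_hom_product); case: in_a_operator.
split=> [E m n|E].
  have := congr1 (fun h : C => (h [:: (0, m); (0, n)]).1) E; rewrite PDE /=.
  by move/(mulrn_char0 charK) => /(_ isT) /eqP; rewrite subr_eq0 => /eqP.
apply/funext => -[|u [|v [|w s]]]; try by rewrite /projP Dh.2.
by rewrite PDE E subrr mul0rn.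
Qed.

Lemma Maurer_Cartan_structure :
  \sum_(n < 4) inv_fact K n *: Lops (nseq n (0 : int, alpha)) = 0
  <-> relative_RB_algebra mu l r T.
Proof.
(* The argument is made opaque, so that simplification keeps [Lpart] and [apart] folded. *)
have [x xE] : exists x : int * U, x = (0, alpha) by exists (0, alpha).
have xg n : homogeneous W (nseq n x).
  by rewrite xE; apply: homogeneous_nseq; exact: structure_element_graded.
have LE : Lpart x = (1%N, P2) by rewrite xE structure_elementE.
have aE : apart x = (0%N, TV) by rewrite xE structure_elementE.
have x1 : odd_deg x = false by rewrite xE.
rewrite -xE; move: x {xE} xg LE aE x1 => x xg LE aE x1.
have L1 : Lops (nseq 1%N x) = 0 by apply: injective_projections.
have D1 : derived x [:: x] = 0.
  rewrite /derived -[map _ _]/[:: apart x] LE aE (projP_chain charK in_Lprime_product) //.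
  by split=> //; exact: in_a_operator.
have D2 : derived x [:: x; x] = projP (br (br (1%N, P2) (0%N, TV)) (0%N, TV)).2.
  by rewrite /derived -[map _ _]/[:: apart x; apart x] LE aE.
have L2 : Lops (nseq 2%N x) = (- (br (1%N, P2) (1%N, P2)).2, 0).
  apply: injective_projections.
    by rewrite -[nseq 2%N x]/[:: x; x] Lops_fst2 LE x1 expr1 scaleN1r.
  by rewrite [LHS](Lops_derived charK (xg 2%N)) [pull _ _ _]/= D1 scaler0 !addr0.
(* The factor 3 is the choice of the argument that supplies [pi]; all signs are trivial in degree
   0. *)
have L3 : Lops (nseq 3%N x) = (0, projP (br (br (1%N, P2) (0%N, TV)) (0%N, TV)).2 *+ 3).
  apply: injective_projections => //.
  rewrite [LHS](Lops_derived charK (xg 3%N)) [pull _ _ _]/= D2 x1 !scale1r addr0.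
  by rewrite [(_, _).2]/= !mulrS mulr0n addr0.
have -> : \sum_(n < 4) inv_fact K n *: Lops (nseq n x)
    = (- (inv_fact K 2 *: (br (1%N, P2) (1%N, P2)).2),
       inv_fact K 3 *: (projP (br (br (1%N, P2) (0%N, TV)) (0%N, TV)).2 *+ 3)).
  move: L2 L3; set q := (br _ _).2; set t := projP _; move: q t => q t L2 L3.
  rewrite [nseq _ _]/= in L1 L2 L3.
  rewrite !big_ord_recr big_ord0 /= L1 L2 L3 -[Lops [::]]/(0 : U) !scaler0 !add0r.
  by apply: injective_projections; rewrite /= ?scaler0 ?addr0 ?add0r ?scalerN.
have c0 n : inv_fact K n != 0 by rewrite invr_eq0 ((pcharf0P K).1 charK) -lt0n fact_gt0.
split=> [E|[[_ mA] [_ _ lA rA lr] _ TT]].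
  have /eqP := congr1 fst E; rewrite oppr_eq0 scaler_eq0 (negbTE (c0 _)) => /eqP.
  case/product_square_eq0 => mA lA rA lr.
  have /eqP := congr1 snd E; rewrite scaler_eq0 (negbTE (c0 _)) => /eqP.
  by move=> /(mulrn_char0 charK) => /(_ isT) /operator_eq0 TT.
rewrite (product_square_eq0.2 _) // (operator_eq0.2 _) //.
by rewrite mul0rn !scaler0 oppr0.
Qed.

End StructureElement.

Lemma structure_elementD (K : fieldType) (A M : lmodType K) mu mu' l l' r r' (T T' : M -> A) :
  structure_element mu l r T + structure_element mu' l' r' T'
  = structure_element (fun a b : A => mu a b + mu' a b) (fun a m => l a m + l' a m)
      (fun m a => r m a + r' m a) (fun m => T m + T' m).
Proof.
rewrite !structure_elementE; congr pair; apply/funext => -[|u [|v [|w s]]];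
  rewrite !addrfctE /= ?addr0 //; apply: injective_projections; rewrite //= ?addr0 //.
exact: addrACA.
Qed.

Theorem theorem4p4 (K : fieldType) (charK : has_pchar0 K)
    (A M : lmodType K) (mu : A -> A -> A) (l : A -> M -> M) (r : M -> A -> M)
    (T : M -> A) (hT : relative_RB_algebra mu l r T) :
  let W := @graded_total K A M in
  let lT := twist (@Lops K A M) (structure_element mu l r T) in
  Linfty1_algebra W lT /\
  (forall (mu' : A -> A -> A) (l' : A -> M -> M) (r' : M -> A -> M)
          (T' : M -> A),
    is_bilinear mu' -> is_bilinear l' -> is_bilinear r' -> linear T' ->
    (relative_RB_algebra (fun a b => mu a b + mu' a b)
       (fun a m => l a m + l' a m) (fun m a => r m a + r' m a)
       (fun m => T m + T' m)
     <-> Maurer_Cartan W lT (structure_element mu' l' r' T'))).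
Proof.
move=> W lT.
have [[mub mua] [lb rb _ _ _] Tl _] := hT.
have ll := @Lops_list_Linfty1 K A M charK.
have ag := structure_element_graded mub lb rb Tl.
have MC := (Maurer_Cartan_structure charK mub lb rb Tl).2 hT.
have van X : homogeneous W X -> all (fun x => x.1 == 0) X -> (3 < size X)%N -> Lops X = 0.
  move=> Xg X0 sX; apply: (Lops_vanish charK (N := 1)) => //; last exact: ltnW.
  by apply: sub_all X0 => x /eqP x0; rewrite /Lpart /= x0.
split.
  apply: list_Linfty1_algebra; apply: (list_Linfty1_twist charK ll ag).
    by move=> X; apply: Lops_nilpotent.
  (* The value of the twist on the empty list is the left side of the Maurer-Cartan equation of
     [(pi[1], T)], cut off at 4. *)
  rewrite (@twist_sum _ _ _ _ _ 4) => [|n n4].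
    by under eq_bigr do rewrite cats0.
  by rewrite cats0 van ?size_nseq ?homogeneous_nseq // all_nseq eqxx orbT.
move=> mu' l' r' T' mub' lb' rb' Tl'.
have ag' := structure_element_graded mub' lb' rb' Tl'.
rewrite (Maurer_Cartan_twist charK ll ag ag' (N := 4)) //; last first.
  move=> n k nk; apply: van.
  - by rewrite homogeneous_cat !homogeneous_nseq.
  - by rewrite all_cat !all_nseq !eqxx !orbT.
  by rewrite size_cat !size_nseq.
rewrite structure_elementD; apply: iff_sym; apply: Maurer_Cartan_structure => //.
- exact: bilinearD.
- exact: bilinearD.
- exact: bilinearD.
by move=> c u v; rewrite Tl Tl' scalerDr addrACA.
Qed.
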